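(* Let $q$ be an odd prime power, $k=\mathbb{F}_q$, $b\in k$ with $b^2\notin\{0,1\}$, $K_q=k(u)$, $t=u^q-u$, and let $E/K_q$ be $Y^2=X(X+16b^2)(X+t^2)$. For $\alpha\in\mathbb{F}_q$ let $P_\alpha\in E(K_q)$ be the point $$X=4bt\,\frac{(u-\alpha)^q+4b}{u-\alpha},\qquad Y=\frac{4bt(4b+t)\,\big((u-\alpha)^2+4b(u-\alpha)\big)^{(q+1)/2}}{(u-\alpha)^2}.$$ Let $\chi$ be the non-trivial quadratic character of $\mathbb{F}_q^\times$ (extended by $\chi(0)=0$), and for $\gamma\in\mathbb{F}_q$ put $$tr_\gamma=-1-\sum_{\beta\in\mathbb{F}_q}\chi\big(\beta(\beta+4b)(\beta-\gamma)(\beta-\gamma+4b)\big).$$ Then the height pairing satisfies $$\langle P_\alpha,P_\beta\rangle=\begin{cases}\frac{(3q-1)(q-1)}{4q}+\frac12&\text{if }\alpha=\beta,\\[2pt] \frac{1-3q}{4q}+\frac14\chi(-1)&\text{if }\alpha-\beta=\pm4b,\\[2pt] \frac{1-3q}{4q}+\frac14tr_{\alpha-\beta}&\text{if }\alpha-\beta\neq0,\pm4b.\end{cases}$$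
   Context: The canonical (Néron–Tate) height pairing is normalized so that factors of $\log|k|$ are removed; equivalently it is given by $\langle P,Q\rangle=-(P-O)\cdot(Q-O+D_Q)$, with intersection products on the regular minimal model of $E$ over $\mathbb{P}^1_u$, $O$ the zero section, and $D_Q$ the $\mathbb{Q}$-divisor supported on fiber components making $Q-O+D_Q$ orthogonal to all fiber components. Equivalently, $tr_\gamma$ is defined by $\#X'_\gamma(\mathbb{F}_q)=q-tr_\gamma+1$, where $X'_\gamma$ is the smooth projective curve $s_3^2=(s_1^2-4b^2)(s_1^2-2\gamma s_1+\gamma^2-4b^2)$. *)

(* Defs.v *)
From HB Require Import structures.
From mathcomp Require Import all_boot all_order all_algebra.
From mathcomp Require Import generic_quotient fraction.
From mathcomp Require Import all_classical all_reals all_analysis.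
Set Implicit Arguments. Unset Strict Implicit. Unset Printing Implicit Defensive.
Import Order.TTheory GRing.Theory Num.Theory.
Import numFieldNormedType.Exports.
Local Open Scope ring_scope.

Section Defs.
Variable F : finFieldType.

Definition Kq := {fraction {poly F}}.
Definition uK : Kq := tofrac ('X : {poly F}).
Definition cK (c : F) : Kq := tofrac (c%:P).
Definition tK : Kq := uK ^+ #|F| - uK.

Definition rdeg (f : Kq) : nat :=
  let r := repr f in
  let g := gcdp (frac r).1 (frac r).2 in
  (maxn (size ((frac r).1 %/ g)) (size ((frac r).2 %/ g))).-1.

(* points of a Weierstrass curve y^2 = x^3 + a2 x^2 + a4 x + a6 over Kq;
   None is the point at infinity O *)
Definition pt := option (Kq * Kq).

Definition ec_add (a2 a4 : Kq) (P Q : pt) : pt :=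
  match P, Q with
  | None, _ => Q
  | _, None => P
  | Some (x1, y1), Some (x2, y2) =>
      if (x1 == x2) && (y1 == - y2) then None
      else
        let l := if x1 == x2
                 then (3%:R * x1 ^+ 2 + 2%:R * a2 * x1 + a4) / (2%:R * y1)
                 else (y2 - y1) / (x2 - x1) in
        let x3 := l ^+ 2 - a2 - x1 - x2 in
        Some (x3, - (l * (x3 - x1) + y1))
  end.

(* E : Y^2 = X (X + 16 b^2) (X + t^2) = X^3 + (16b^2 + t^2) X^2 + 16 b^2 t^2 X *)
Definition Ea2 (b : F) : Kq := cK (16%:R * b ^+ 2) + tK ^+ 2.
Definition Ea4 (b : F) : Kq := cK (16%:R * b ^+ 2) * tK ^+ 2.
Definition Eadd (b : F) : pt -> pt -> pt := ec_add (Ea2 b) (Ea4 b).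

Definition naive_h (P : pt) : nat := if P is Some (x, _) then rdeg x else 0%N.

(* canonical (Neron-Tate) height, normalized without log|k|:
   hhat P = lim_n deg x(2^n P) / 4^n *)
Definition hhat (R : realType) (b : F) (P : pt) : R :=
  limn (fun n : nat => ((naive_h (iter n (fun Q => Eadd b Q Q) P))%:R / 4%:R ^+ n : R)).

Definition height_pairing (R : realType) (b : F) (P Q : pt) : R :=
  (hhat R b (Eadd b P Q) - hhat R b P - hhat R b Q) / 2%:R.

Definition Palpha (b alpha : F) : pt :=
  let w := uK - cK alpha in
  let q := #|F| in
  Some (cK (4%:R * b) * tK * (w ^+ q + cK (4%:R * b)) / w,
        cK (4%:R * b) * tK * (cK (4%:R * b) + tK)
          * (w ^+ 2 + cK (4%:R * b) * w) ^+ (q.+1)./2 / w ^+ 2).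

Definition qchi (R : realType) (x : F) : R :=
  if x == 0 then 0 else if [exists y : F, y ^+ 2 == x] then 1 else -1.

Definition trg (R : realType) (b g : F) : R :=
  -1 - \sum_(be : F) qchi R (be * (be + 4%:R * b) * (be - g) * (be - g + 4%:R * b)).

End Defs.

(* Main.v *)
(** Put c = 4b, e = c^2, so that E is y^2 = x (x + e) (x + t^2).  Its regular model over P^1 has
chi = q and reducible fibres I_{4q} at infinity, I_4 at the zeros of t and I_2 at the zeros of
t^2 - e.  For a point with x = N/D in lowest terms, the number 2 chi + 2 (Q.O) minus the
contributions of these fibres depends only on the degrees of N, D and of gcds of N and N + e D
with t, t^2 and t^2 - e.  Computing the cancellation in the duplication formula place by place
shows that it is exactly multiplied by 4 under doubling; since it differs from the degree of x by
a bounded amount, it is the canonical height.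

With w = u - alpha, z = u - beta, gamma = alpha - beta and k = (q - 1)/2, both x(P_alpha) and
x(P_alpha + P_beta) = w z (w + c) (z + c) T^2 / gamma^2, where
T = ((w + c) z)^k - ((z + c) w)^k, are polynomials.  By Euler's criterion T vanishes at s in F_q
exactly where chi (w z (w + c) (z + c)) = 1, which turns the contribution of the I_4 fibres into
the character sum. *)
Require Import Defs.
From HB Require Import structures.
From mathcomp Require Import all_boot all_order all_fingroup all_solvable all_algebra all_field.
From mathcomp Require Import generic_quotient fraction.
From mathcomp Require Import all_classical all_reals all_analysis.
From mathcomp Require Import zify ring lra.
Set Implicit Arguments. Unset Strict Implicit. Unset Printing Implicit Defensive.
Import Order.TTheory GRing.Theory Num.Theory.
Import numFieldNormedType.Exports.
Local Open Scope ring_scope.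

(** * Multiplicities of roots *)

(** The shape of [x(P_alpha + P_beta)] comes from 2-descent. By [secant_third] the x-coordinates of
    three collinear points multiply to a square, and [x(P_alpha) = c t (w + c)^q / w] with [q] odd;
    so modulo squares [x(P_alpha + P_beta)] is [w z (w + c) (z + c)]. Likewise [x(P_alpha) + e] is
    [c (t + c)] modulo squares for every [alpha], which is why [x(P_alpha + P_beta) + e] is a
    square. The zeros of [t] are the elements of [F], but those of [t^2 - e] lie outside [F], since
    [t] vanishes on [F] and [e] is not 0. Multiplicities are therefore compared over an algebraic
    closure, and the outcome is stated through gcds up to units, which descend to [F]. The
    multiplicity of a zero polynomial carries no information, so the points with [2Q = O] or
    [2Q = (0, 0)] are treated apart, as points of height 0. *)

Section Multiplicity.
Variables (K : fieldType) (r : K).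
Implicit Types p q : {poly K}.

Lemma mup_gcdp p q : p != 0 -> q != 0 -> mup r (gcdp p q) = minn (mup r p) (mup r q).
Proof.
move=> p0 q0; have g0 : gcdp p q != 0 by rewrite gcdp_eq0 negb_and p0.
apply/eqP; rewrite eqn_leq leq_min !mup_geq // -dvdp_gcd.
rewrite -!mup_geq // leqnn /= mup_geq // dvdp_gcd -!mup_geq //.
by rewrite geq_minl geq_minr.
Qed.

Lemma mupXn p n : p != 0 -> mup r (p ^+ n) = (n * mup r p)%N.
Proof.
move=> p0; elim: n => [|n IH]; first by rewrite expr0 mupNroot ?root1.
by rewrite exprS mupM ?expf_neq0 // IH mulSn.
Qed.

Lemma mupN p : mup r (- p) = mup r p.
Proof.
have [->|p0] := eqVneq p 0; first by rewrite oppr0.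
by rewrite -mulN1r mupMr // rootN root1.
Qed.

Lemma mupZ (a : K) p : a != 0 -> mup r (a *: p) = mup r p.
Proof. by move=> a0; rewrite -mul_polyC mupMr // rootC. Qed.

Lemma mupD_geq n p q : p + q != 0 -> p != 0 -> q != 0 ->
  (n <= mup r p)%N -> (n <= mup r q)%N -> (n <= mup r (p + q))%N.
Proof. by move=> pq0 p0 q0; rewrite !mup_geq // => np nq; rewrite dvdp_add. Qed.

Lemma mupD_lt p q : p != 0 -> q != 0 -> (mup r p < mup r q)%N ->
  p + q != 0 /\ mup r (p + q) = mup r p.
Proof.
move=> p0 q0 lt_pq; have pq0 : p + q != 0.
  by rewrite addr_eq0; apply/eqP => pq; rewrite pq mupN ltnn in lt_pq.
split=> //; apply/eqP; rewrite eqn_leq mupD_geq ?(ltnW lt_pq) // andbT leqNgt.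
apply/negP; rewrite mup_geq // dvdp_addl -?mup_geq //.
by rewrite ltnn.
Qed.

Lemma mup_root p : p != 0 -> root p r = (0 < mup r p)%N.
Proof. by move=> p0; rewrite -XsubC_dvd // dvdp_XsubCl. Qed.

Lemma mup_deriv p : p != 0 -> ~~ root p^`() r -> (mup r p <= 1)%N.
Proof.
move=> p0; apply: contraR; rewrite -ltnNge mup_geq // => /dvdpP [s ->].
by rewrite expr2 !derivM derivXsubC rootE !hornerE /= !subrr !(mulr0, add0r, subrr).
Qed.

End Multiplicity.

Lemma dvdp_mup (L : closedFieldType) (p q : {poly L}) : p != 0 -> q != 0 ->
  (forall r, (mup r p <= mup r q)%N) -> p %| q.
Proof.
move: {2}(size p) (leqnn (size p)) => n; elim: n p q => [|n IH] p q.
  by rewrite size_poly_leq0 => /eqP -> /eqP.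
move=> sp p0 q0 le_pq; have [sp1|sp1] := eqVneq (size p) 1%N.
  by have /eqp_dvdl -> : p %= 1; rewrite ?dvd1p // -size_poly_eq1 sp1.
have /closed_rootP [r rp] := sp1.
have /factor_theorem [p1 Ep] := rp.
have : root q r by rewrite mup_root //; apply: leq_trans (le_pq r); rewrite -mup_root.
move=> /factor_theorem [q1 Eq]; move: p0 q0 sp le_pq; rewrite Ep Eq.
rewrite !mulf_eq0 !negb_or => /andP [p10 X0] /andP [q10 _].
rewrite size_Mmonic ?monicXsubC // size_XsubC addn2 /= ltnS => sp le_pq.
apply: dvdp_mul => //; apply: IH => // s.
by have := le_pq s; rewrite !mupM // leq_add2r.
Qed.

Lemma eqp_mup (L : closedFieldType) (p q : {poly L}) : p != 0 -> q != 0 ->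
  (forall r, mup r p = mup r q) -> p %= q.
Proof.
by move=> p0 q0 E; rewrite /eqp !dvdp_mup // => r; rewrite E.
Qed.

Lemma mup_map (K L : fieldType) (f : {rmorphism K -> L}) (p : {poly K}) r :
  p != 0 -> mup (f r) (map_poly f p) = mup r p.
Proof.
move=> p0; have fp0 : map_poly f p != 0 by rewrite map_poly_eq0.
have E n : (n <= mup (f r) (map_poly f p))%N = (n <= mup r p)%N.
  by rewrite !mup_geq // -(dvdp_map f) rmorphXn rmorphB /= map_polyX map_polyC.
by apply/eqP; rewrite eqn_leq E leqnn -E leqnn.
Qed.

(** * Cancellation in the duplication formula at one place *)

Definition horner_opE := (hornerD, hornerN, hornerX, hornerC, horner_exp, hornerM).

(* If x(Q) = N/D on y^2 = x (x + e) (x + t^2), then x(2Q) = dbl_num/dbl_den, not in lowest terms. *)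
Definition dbl_num (K : fieldType) (e t N D : {poly K}) := (N ^+ 2 - e * t ^+ 2 * D ^+ 2) ^+ 2.
Definition dbl_den (K : fieldType) (e t N D : {poly K}) :=
  4%:R * N * D * (N + e * D) * (N + t ^+ 2 * D).

(* x + e is a square up to the factor 4 y^2 because (-e, 0) is a 2-torsion point. *)
Lemma dbl_num_add_den (K : fieldType) (e t N D : {poly K}) :
  dbl_num e t N D + e * dbl_den e t N D = ((N + e * D) ^+ 2 + e * (t ^+ 2 - e) * D ^+ 2) ^+ 2.
Proof. rewrite /dbl_num /dbl_den; ring. Qed.

Section Local.
Variables (K : fieldType) (c : K) (t N D : {poly K}) (r : K).
Local Notation e := ((c ^+ 2)%:P).
Local Notation E := (N + e * D).
Local Notation M := (N + t ^+ 2 * D).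
Local Notation P := (t ^+ 2 - e).
Local Notation v := (mup r).
Local Notation N0 := (dbl_num e t N D).
Local Notation D0 := (dbl_den e t N D).
Local Notation G := (gcdp N0 D0).
Hypotheses (two0 : 2%:R != 0 :> K) (c0 : c != 0) (coND : coprimep N D).
Hypotheses (N0_0 : N0 != 0) (D0_0 : D0 != 0).
Hypotheses (t0 : t != 0) (vt : (v t <= 1)%N) (P0 : P != 0) (vP : (v P <= 1)%N).

Let four0 : 4%:R != 0 :> K.
Proof. by rewrite (natrM _ 2 2) mulf_neq0. Qed.
Let four_e : (4%:R : {poly K}) = 4%:R%:P. Proof. by rewrite polyC_natr. Qed.
Let four0p : 4%:R != 0 :> {poly K}. Proof. by rewrite four_e polyC_eq0. Qed.
Let e0 : e != 0. Proof. by rewrite polyC_eq0 expf_neq0. Qed.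

Lemma dbl_den_neq0 : [/\ N != 0, D != 0, E != 0 & M != 0].
Proof. by move: D0_0; rewrite /dbl_den !mulf_eq0 !negb_or -!andbA => /and5P []. Qed.

Let Nn0 : N != 0. Proof. by case: dbl_den_neq0. Qed.
Let Dn0 : D != 0. Proof. by case: dbl_den_neq0. Qed.
Let En0 : E != 0. Proof. by case: dbl_den_neq0. Qed.
Let Mn0 : M != 0. Proof. by case: dbl_den_neq0. Qed.

Let W0 : N ^+ 2 - e * t ^+ 2 * D ^+ 2 != 0.
Proof. by move: N0_0; rewrite /dbl_num expf_eq0. Qed.

Let ve : v e = 0%N. Proof. by rewrite mupNroot // rootC expf_neq0. Qed.

Lemma mup_dbl_den : v D0 = (v N + v D + v E + v M)%N.
Proof. by rewrite /dbl_den !mupM ?mulf_neq0 // {1}four_e (@mupNroot _ _ 4%:R%:P) ?rootC. Qed.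

Let notND : root N r -> root D r -> false.
Proof. by move=> rN rD; have := coprimep_root coND rN; rewrite -rootE rD. Qed.

(** At a place of good reduction nothing cancels: the denominator vanishes only where [x(Q)] is
    infinite, [0], [-e] or [-t^2], and there the numerator is a unit times [N^4] or [D^4]. *)
Lemma mup_gcd_regular : ~~ root t r -> ~~ root P r -> v G = 0%N.
Proof.
move=> tr Pr; apply: mupNroot; rewrite root_gcd; apply/negP => /andP [].
move: tr Pr (@notND); rewrite /dbl_num /dbl_den four_e /root !horner_opE.
set n := N.[r]; set d := D.[r]; set x := t.[r] => x0 Px nd.
have {}nd : n = 0 -> d = 0 -> False by move=> n0 d0; move: nd; rewrite n0 d0 eqxx => /(_ isT isT).
rewrite mulf_eq0 orbb => /eqP W; rewrite !mulf_eq0 (negPf four0) /= -!orbA.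
case/or4P => /eqP Z.
- have : c ^+ 2 * x ^+ 2 * d ^+ 2 == 0.
    by rewrite -oppr_eq0; apply/eqP; rewrite -[RHS]W Z; ring.
  by rewrite !mulf_eq0 (negPf c0) (negPf x0) /= orbb => /eqP d0; apply: nd; rewrite ?Z ?d0.
- have : n ^+ 2 == 0 by apply/eqP; rewrite -[RHS]W Z; ring.
  rewrite expf_eq0 /= => /eqP n0.
  by apply: nd; rewrite ?Z ?n0.
- have {}Z : n = - (c ^+ 2 * d) by apply/eqP; rewrite -addr_eq0 Z.
  have : c ^+ 2 * (x ^+ 2 - c ^+ 2) * d ^+ 2 == 0.
    by rewrite -oppr_eq0; apply/eqP; rewrite -[RHS]W Z; ring.
  rewrite !mulf_eq0 (negPf c0) (negPf Px) /= orbb => /eqP d0.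
  by apply: nd; rewrite ?Z ?d0 ?mulr0 ?oppr0.
- have {}Z : n = - (x ^+ 2 * d) by apply/eqP; rewrite -addr_eq0 Z.
  have : x ^+ 2 * (x ^+ 2 - c ^+ 2) * d ^+ 2 == 0.
    by apply/eqP; rewrite -[RHS]W Z; ring.
  rewrite !mulf_eq0 (negPf Px) (negPf x0) /= orbb => /eqP d0.
  by apply: nd; rewrite ?Z ?d0 ?mulr0 ?oppr0.
Qed.

(* min (v N) 2 is, up to sign, the component of the I_4 fibre met by the point. *)
Lemma mup_gcd_t : root t r ->
  [/\ v G = (2 * minn (v N) 2)%N, (v N == 1%N -> 4 <= v N0)%N &
      (v N != 1%N -> v N0 = 2 * minn (v N) 2)%N].
Proof.
move=> tr; have vt1 : v t = 1%N by apply/eqP; rewrite eqn_leq vt -mup_root.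
have vt2 : v (t ^+ 2) = 2%N by rewrite mupXn // vt1.
rewrite mup_gcdp // mup_dbl_den {1 2 3}/dbl_num !mupXn //.
have [Nr|Nr] := boolP (root N r); last first.
  have vN : v N = 0%N by rewrite mupNroot.
  have vW : v (N ^+ 2 - e * t ^+ 2 * D ^+ 2) = 0%N.
    apply: mupNroot; rewrite /root !horner_opE (eqP tr) expr0n mulr0 mul0r subr0.
    by rewrite expf_neq0.
  by rewrite vN vW; split; rewrite ?min0n.
have Dr : ~~ root D r by apply/negP => /(notND Nr).
have vD : v D = 0%N by rewrite mupNroot.
have vE : v E = 0%N.
  by rewrite mupNroot // /root !horner_opE (eqP Nr) add0r mulf_neq0 // expf_neq0.
have vN1 : (0 < v N)%N by rewrite -mup_root.
have t2D0 : t ^+ 2 * D != 0 by rewrite mulf_neq0 ?expf_neq0.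
have vtD : v (t ^+ 2 * D) = 2%N by rewrite mupM ?expf_neq0 // vt2 vD.
have A0 : - (e * t ^+ 2 * D ^+ 2) != 0 by rewrite oppr_eq0 !mulf_neq0 // ?expf_neq0.
have vA : v (- (e * t ^+ 2 * D ^+ 2)) = 2%N.
  by rewrite mupN 2?mupM ?mulf_neq0 ?expf_neq0 // ve !mupXn // vt1 vD.
have vN2 : v (N ^+ 2) = (2 * v N)%N by rewrite mupXn.
(* On components 1 and 3 both terms of [N^2 - e t^2 D^2] have valuation 2 and may cancel further, so
   [v N0] is only bounded below and [v D0 = 2] fixes the gcd. On component 2 the roles are
   exchanged: [v N0 = 4], and [v D0] is at least 4. *)
rewrite vD vE; have [vN|vN] := eqVneq (v N) 1%N.
  have [_ vM] : M != 0 /\ v M = v N by apply: mupD_lt => //; rewrite vtD vN.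
  have vW : (2 <= v (N ^+ 2 - e * t ^+ 2 * D ^+ 2))%N.
    by apply: mupD_geq; rewrite ?expf_neq0 // ?vA // vN2 vN.
  rewrite vM vN; split=> // [|_]; last by rewrite -[4%N]/(2 * 2)%N leq_mul2l.
  by rewrite (minn_idPr _) // (leq_trans _ (leq_mul (leqnn 2) vW)).
have {}vN : (2 <= v N)%N by rewrite ltn_neqAle eq_sym vN.
have vM : (2 <= v M)%N by apply: mupD_geq; rewrite // vtD.
have N20 : N ^+ 2 != 0 by rewrite expf_neq0.
have lt_v : (v (- (e * t ^+ 2 * D ^+ 2)) < v (N ^+ 2))%N.
  by rewrite vA vN2 -[2%N]/(2 * 1)%N ltn_mul2l.
have [_ vW] := mupD_lt A0 N20 lt_v; rewrite vA in vW.
rewrite addrC vW (minn_idPr vN); split=> //.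
by rewrite (minn_idPl _) // !addn0 (leq_add vN vM).
Qed.

Local Notation V := (E ^+ 2 + e * P * D ^+ 2).

(* min (v E) 1 is the component of the I_2 fibre met by the point. *)
Lemma mup_gcd_P : root P r ->
  [/\ v G = (2 * minn (v E) 1)%N, V != 0 & v (V ^+ 2) = v G].
Proof.
move=> Pr; have vP1 : v P = 1%N by apply/eqP; rewrite eqn_leq vP -mup_root.
(* [V ^+ 2] is [N0 + e * D0], so its valuation, which is easy to read off, bounds that of the
   gcd. *)
have G_V : G %| V ^+ 2 by rewrite -dbl_num_add_den dvdp_add ?dvdp_gcdl // dvdp_mull // dvdp_gcdr.
have G0 : G != 0 by rewrite gcdp_eq0 negb_and N0_0.
have [Er|Er] := boolP (root E r); last first.
  have Vr : ~~ root V r.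
    by rewrite /root hornerD horner_exp 2!hornerM (eqP Pr) mulr0 mul0r addr0 expf_neq0.
  have V0 : V != 0 by apply: contraNneq Vr => ->; rewrite root0.
  have vG : v G = 0%N.
    have Vr2 : ~~ root (V ^+ 2) r by rewrite /root horner_exp expf_neq0.
    by apply: mupNroot; apply: contra Vr2; rewrite -!dvdp_XsubCl => /dvdp_trans; apply.
  split; rewrite // vG ?mupXn // ?(mupNroot Er) // mupNroot //.
have Dr : ~~ root D r.
  apply/negP => Dr; suff Nr : root N r by have := notND Nr Dr.
  move: Er; rewrite /root !horner_opE (eqP Dr).
  by rewrite mulr0 addr0.
have vD : v D = 0%N by rewrite mupNroot.
have vE : (0 < v E)%N by rewrite -mup_root.
have vePD : v (e * P * D ^+ 2) = 1%N.
  by rewrite 2?mupM ?mulf_neq0 ?expf_neq0 // ve vP1 !mupXn // vD.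
have ePD0 : e * P * D ^+ 2 != 0 by rewrite !mulf_neq0.
have E20 : E ^+ 2 != 0 by rewrite expf_neq0.
have lt_v : (v (e * P * D ^+ 2) < v (E ^+ 2))%N.
  by rewrite vePD mupXn // -[1%N]/(1 * 1)%N; apply: (@leq_mul 2 1).
have [V0 vV] := mupD_lt ePD0 E20 lt_v; rewrite vePD in vV.
rewrite addrC in V0 vV.
have vM : (1 <= v M)%N.
  have EM : M = E + P * D by ring.
  by rewrite EM; apply: mupD_geq; rewrite -?EM ?mulf_neq0 // mupM // vP1 vD.
have vV2 : v (V ^+ 2) = 2%N by rewrite mupXn // vV.
have vG : v G = 2%N.
  apply/eqP; rewrite eqn_leq; apply/andP; split.
    have : (v G <= v (V ^+ 2))%N; last by rewrite vV2.
    by rewrite mup_geq ?expf_neq0 //; apply: dvdp_trans G_V; rewrite -mup_geq.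
  have d2D : ('X - r%:P) ^+ 2 %| D0 by rewrite -mup_geq // mup_dbl_den (leq_add (leq_trans vE (leq_addl _ _)) vM).
  rewrite mup_geq // dvdp_gcd d2D andbT -(dvdp_addl _ (dvdp_mull e d2D)) dbl_num_add_den.
  by rewrite -mup_geq ?expf_neq0 // vV2.
by rewrite vG (minn_idPr vE) vV2.
Qed.

End Local.

(** * Cancellation in the duplication formula *)

Lemma map_dbl_num (K L : fieldType) (f : {rmorphism K -> L}) (e t N D : {poly K}) :
  map_poly f (dbl_num e t N D) = dbl_num (map_poly f e) (map_poly f t) (map_poly f N) (map_poly f D).
Proof. by rewrite /dbl_num !(rmorphXn, rmorphB, rmorphM) /=. Qed.

Lemma map_dbl_den (K L : fieldType) (f : {rmorphism K -> L}) (e t N D : {poly K}) :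
  map_poly f (dbl_den e t N D) = dbl_den (map_poly f e) (map_poly f t) (map_poly f N) (map_poly f D).
Proof.
by rewrite /dbl_den -!polyC_natr !(rmorphM, rmorphXn, rmorphD) /= map_polyC /= rmorph1.
Qed.

Section Closed.
Variables (L : closedFieldType) (c : L) (t N D : {poly L}).
Local Notation e := ((c ^+ 2)%:P).
Local Notation E := (N + e * D).
Local Notation P := (t ^+ 2 - e).
Local Notation N0 := (dbl_num e t N D).
Local Notation D0 := (dbl_den e t N D).
Local Notation G := (gcdp N0 D0).
Local Notation N' := (N0 %/ G).
Local Notation D' := (D0 %/ G).
Hypotheses (two0 : 2%:R != 0 :> L) (c0 : c != 0) (coND : coprimep N D).
Hypotheses (N0_0 : N0 != 0) (D0_0 : D0 != 0) (dt : t^`() = -1).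

Let t0 : t != 0.
Proof.
by apply/eqP => t0; move/eqP: dt; rewrite t0 raddf0 eq_sym oppr_eq0 oner_eq0.
Qed.

Let P0 : P != 0.
Proof.
apply/eqP => /(congr1 (@deriv L)) /eqP.
rewrite derivB derivC subr0 expr2 derivM dt raddf0 mulN1r mulrN1 -opprD oppr_eq0.
by rewrite -mulr2n -mulr_natl mulf_eq0 (negPf t0) -polyC_natr polyC_eq0 (negPf two0).
Qed.

Let vt r : (mup r t <= 1)%N.
Proof. by apply: mup_deriv; rewrite // dt /root horner_opE hornerC oppr_eq0 oner_eq0. Qed.

Let root_tP r : root t r -> ~~ root P r.
Proof.
by move=> tr; rewrite /root !horner_opE (eqP tr) expr0n sub0r oppr_eq0 expf_neq0.
Qed.

(** The derivative of [t^2 - e] is [-2t], and where [t] vanishes [t^2 - e] takes the nonzero value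
    [-e]. *)
Let vP r : (mup r P <= 1)%N.
Proof.
have [tr|tr] := boolP (root t r); first by rewrite mupNroot ?root_tP.
apply: mup_deriv => //; rewrite derivB derivC subr0 expr2 derivM dt mulN1r mulrN1 -opprD.
by rewrite rootN -mulr2n -mulr_natl rootM -polyC_natr rootC negb_or two0.
Qed.

Let G0 : G != 0. Proof. by rewrite gcdp_eq0 negb_and N0_0. Qed.
Let N'E : N' * G = N0. Proof. by rewrite divpK ?dvdp_gcdl. Qed.
Let D'E : D' * G = D0. Proof. by rewrite divpK ?dvdp_gcdr. Qed.
Let N'0 : N' != 0.
Proof. by apply: contraNneq N0_0 => N'0; rewrite -N'E N'0 mul0r. Qed.
Let Nn0 : N != 0. Proof. by case: (dbl_den_neq0 D0_0). Qed.
Let En0 : E != 0. Proof. by case: (dbl_den_neq0 D0_0). Qed.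
Let t20 : t ^+ 2 != 0. Proof. by rewrite expf_neq0. Qed.

Let vN' r : mup r N0 = (mup r N' + mup r G)%N.
Proof. by rewrite -{1}N'E mupM. Qed.

Let vt2 r : mup r (t ^+ 2) = (2 * mup r t)%N. Proof. by rewrite mupXn. Qed.

Let cases r : [\/ root t r /\ ~~ root P r, ~~ root t r /\ root P r | ~~ root t r /\ ~~ root P r].
Proof.
have [tr|tr] := boolP (root t r); first by constructor 1; split=> //; apply: root_tP.
by have [Pr|Pr] := boolP (root P r); [constructor 2 | constructor 3].
Qed.

Let vt1 r : root t r -> mup r t = 1%N.
Proof. by move=> tr; apply/eqP; rewrite eqn_leq vt -mup_root. Qed.

(** The places where cancellation occurs are simple and disjoint zeros of [t] and [P], so the local
    exponents [2 min(v N, 2)] and [2 min(v E, 1)] are exactly those of the two gcds. *)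
Lemma gcd_dbl_closed : G %= gcdp N (t ^+ 2) ^+ 2 * gcdp E P ^+ 2.
Proof.
have g1 : gcdp N (t ^+ 2) != 0 by rewrite gcdp_eq0 negb_and Nn0.
have g2 : gcdp E P != 0 by rewrite gcdp_eq0 negb_and En0.
apply: eqp_mup => // [|r]; first by rewrite mulf_neq0 ?expf_neq0.
rewrite mupM ?expf_neq0 // !mupXn // !mup_gcdp // vt2.
rewrite -mup_gcdp //; case: (cases r) => [] [tr Pr].
- have [vG _ _] := mup_gcd_t two0 c0 coND N0_0 D0_0 t0 (vt r) tr.
  by rewrite vG (vt1 tr) (mupNroot Pr) minn0 muln0 addn0.
- have [vG _ _] := mup_gcd_P two0 c0 coND N0_0 D0_0 P0 (vP r) Pr.
  have vP1 : mup r P = 1%N by apply/eqP; rewrite eqn_leq vP -mup_root.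
  by rewrite vG vP1 (mupNroot tr) muln0 ?minn0 ?muln0 add0n.
- by rewrite (mup_gcd_regular two0 c0 coND tr Pr) (mupNroot tr) (mupNroot Pr) ?muln0 ?minn0 ?muln0.
Qed.

(** Doubling in the component group [Z/4] sends the components 0, 1, 2 to 0, 2, 0; the exponents on
    the two sides then read [0 + 0 = 0], [1 + 1 = 2] and [0 + 2 = 2]. *)
Lemma gcd_num_t_closed : gcdp N' t * gcdp N (t ^+ 2) %= gcdp N t ^+ 2.
Proof.
have g1 : gcdp N (t ^+ 2) != 0 by rewrite gcdp_eq0 negb_and Nn0.
have g2 : gcdp N t != 0 by rewrite gcdp_eq0 negb_and Nn0.
have g3 : gcdp N' t != 0 by rewrite gcdp_eq0 negb_and N'0.
apply: eqp_mup; rewrite ?mulf_neq0 ?expf_neq0 // => r.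
rewrite mupM // !mupXn // !mup_gcdp // vt2.
have [tr|tr] := boolP (root t r); last by rewrite (mupNroot tr) !minn0.
have [vG v1 v2] := mup_gcd_t two0 c0 coND N0_0 D0_0 t0 (vt r) tr.
move: v1 v2; rewrite vN' vG (vt1 tr); move: (mup r N) (mup r N').
by clear=> n n'; case: eqP => [->|n1] v1 v2; [have := v1 isT | have := v2 isT]; lia.
Qed.

(** A double meets only components 0 and 2 of an I_4 fibre, so a zero of [N'] at a zero of [t] is
    never simple. *)
Lemma gcd_num_t2_closed : gcdp N' (t ^+ 2) %= gcdp N' t ^+ 2.
Proof.
have g2 : gcdp N' (t ^+ 2) != 0 by rewrite gcdp_eq0 negb_and N'0.
have g3 : gcdp N' t != 0 by rewrite gcdp_eq0 negb_and N'0.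
apply: eqp_mup; rewrite ?expf_neq0 // => r.
rewrite !mupXn // !mup_gcdp // vt2.
have [tr|tr] := boolP (root t r); last by rewrite (mupNroot tr) !minn0.
have [vG v1 v2] := mup_gcd_t two0 c0 coND N0_0 D0_0 t0 (vt r) tr.
move: v1 v2; rewrite vN' vG (vt1 tr); move: (mup r N) (mup r N').
by clear=> n n'; case: eqP => [->|n1] v1 v2; [have := v1 isT | have := v2 isT]; lia.
Qed.

(** The component group [Z/2] is killed by doubling: [N' + e * D'] is [V ^+ 2] divided by the gcd,
    and both have the same valuation at the zeros of [P]. *)
Lemma coprime_num_P_closed : coprimep (N' + e * D') P.
Proof.
rewrite coprimep_sym; apply/Pdiv.ClosedField.coprimepP => r Pr; apply/negP => Er.
have [vG V0 vV] := mup_gcd_P two0 c0 coND N0_0 D0_0 P0 (vP r) Pr.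
have VE : (E ^+ 2 + e * P * D ^+ 2) ^+ 2 = (N' + e * D') * G.
  by rewrite [RHS]mulrDl -[X in _ = _ + X]mulrA N'E D'E dbl_num_add_den.
have E'0 : N' + e * D' != 0.
  by apply: contraNneq V0 => E'0; rewrite -sqrf_eq0 VE E'0 mul0r.
move: vV; rewrite VE.
rewrite mupM // => /eqP; rewrite -[X in _ == X]add0n eqn_add2r => /eqP.
by move/eqP; rewrite -leqn0 leqNgt -mup_root // /root Er.
Qed.

End Closed.

Section Global.
Variables (F : countFieldType) (c : F) (t N D : {poly F}).
Local Notation e := ((c ^+ 2)%:P).
Local Notation E := (N + e * D).
Local Notation P := (t ^+ 2 - e).
Local Notation N0 := (dbl_num e t N D).
Local Notation D0 := (dbl_den e t N D).
Local Notation G := (gcdp N0 D0).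
Local Notation N' := (N0 %/ G).
Local Notation D' := (D0 %/ G).
Hypotheses (two0 : 2%:R != 0 :> F) (c0 : c != 0) (coND : coprimep N D).
Hypotheses (N0_0 : N0 != 0) (D0_0 : D0 != 0) (dt : t^`() = -1).

(** The zeros of [P] need not lie in [F]; gcds, quotients and association of polynomials are
    compatible with extension to an algebraic closure. *)
Lemma gcd_dbl :
  [/\ G %= gcdp N (t ^+ 2) ^+ 2 * gcdp E P ^+ 2,
      gcdp N' t * gcdp N (t ^+ 2) %= gcdp N t ^+ 2,
      gcdp N' (t ^+ 2) %= gcdp N' t ^+ 2 & coprimep (N' + e * D') P].
Proof.
have [L [f _]] := countable_algebraic_closure F.
have two0L : 2%:R != 0 :> L by rewrite -(rmorph_nat f) fmorph_eq0.
have c0L : f c != 0 by rewrite fmorph_eq0.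
have mapE : map_poly f e = ((f c) ^+ 2)%:P by rewrite map_polyC /= rmorphXn.
have coL : coprimep (map_poly f N) (map_poly f D) by rewrite coprimep_map.
have NL : dbl_num ((f c) ^+ 2)%:P (map_poly f t) (map_poly f N) (map_poly f D) != 0.
  by rewrite -mapE -map_dbl_num map_poly_eq0.
have DL : dbl_den ((f c) ^+ 2)%:P (map_poly f t) (map_poly f N) (map_poly f D) != 0.
  by rewrite -mapE -map_dbl_den map_poly_eq0.
have dtL : (map_poly f t)^`() = -1 by rewrite deriv_map dt rmorphN1.
have := gcd_dbl_closed two0L c0L coL NL DL dtL.
have := gcd_num_t_closed two0L c0L coL NL DL dtL.
have := gcd_num_t2_closed two0L c0L coL NL DL dtL.
have := coprime_num_P_closed two0L c0L coL NL DL dtL.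
rewrite -mapE -map_dbl_num -map_dbl_den; move: (dbl_num _ _ _ _) (dbl_den _ _ _ _) => n0 d0.
by rewrite -(rmorphXn (map_poly f)) -(rmorphB (map_poly f)) -!(rmorphM (map_poly f))
  -!(rmorphD (map_poly f)) -!gcdp_map -!map_divp -!(rmorphM (map_poly f))
  -!(rmorphD (map_poly f)) -!(rmorphXn (map_poly f)) -!(rmorphM (map_poly f)) -!gcdp_map
  -!(rmorphXn (map_poly f)) -!(rmorphM (map_poly f)) !eqp_map coprimep_map.
Qed.

Lemma coprime_dbl_red : coprimep N' D'.
Proof. by rewrite coprimep_div_gcd // D0_0 orbT. Qed.

End Global.

(** * The sum of local heights and duplication *)

(* q = deg t and a, d, sW, sE, sM, a0, d0 are the sizes of N, D, N^2 - e t^2 D^2, N + e D, N + t^2 D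
   and of the unreduced numerator and denominator of x(2Q); m and m' are, up to sign, the components
   of the I_{4q} fibre met by Q and 2Q. *)
Lemma valuation_infinity_dbl (q a d sW sE sM a0 d0 : nat) :
  (0 < q -> 0 < a -> 0 < d -> 0 < sE -> 0 < sM -> 0 < sW ->
  (d + q < a -> sW = 2 * a - 1) -> (a < d + q -> sW = 2 * q + 2 * d - 1) ->
  (a = d + q -> sW <= 2 * a - 1) ->
  (d < a -> sE = a) -> (a <= d -> sE <= d) ->
  (a < 2 * q + d -> sM = 2 * q + d) -> (2 * q + d <= a -> sM <= a) ->
  a0 = 2 * sW - 1 -> d0 = a + d + sE + sM - 3 ->
  let m := minn (2 * q) (2 * q + d - a) in
  let m' := minn (2 * q) (2 * q + d0 - a0) in
  [/\ (maxn (d0 + 2 * q) a0).-1 + 2 * m = 4 * (maxn (d + 2 * q) a).-1 &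
      m' = 2 * m \/ m' + 2 * m = 4 * q])%N.
Proof.
move=> q0 ap dp Ep Mp Wp hW1 hW2 hW3 hE1 hE2 hM1 hM2 Ea0 Ed0 m m'.
have [ha|ha] := leqP (2 * q + d) a.
  have {hM2 hM1} hM := hM2 ha.
  have {hE1 hE2} hE : sE = a by apply: hE1; lia.
  have {hW1 hW2 hW3} hW : sW = (2 * a - 1)%N by apply: hW1; lia.
  have -> : m = 0%N by rewrite /m; lia.
  have -> : m' = 0%N by rewrite /m'; lia.
  rewrite (maxn_idPr _); last lia.
  rewrite (maxn_idPr _); lia.
have {hM2 hM1} hM := hM1 ha.
rewrite [maxn (d + _) a](maxn_idPl _); last lia.
have [had|had] := leqP a d.
  have {hE1 hE2} hE := hE2 had.
  have {hW1 hW2 hW3} hW : sW = (2 * q + 2 * d - 1)%N by apply: hW2; lia.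
  have -> : m = (2 * q)%N by rewrite /m; lia.
  have -> : m' = 0%N by rewrite /m'; lia.
  rewrite (maxn_idPr _); lia.
have {hE1 hE2} hE := hE1 had.
have Em : m = (2 * q + d - a)%N by rewrite /m; lia.
case: (ltngtP (d + q) a) => hda.
- have {hW1 hW2 hW3} hW := hW1 hda.
  have -> : m' = (2 * m)%N by rewrite /m' Em; lia.
  rewrite Em (maxn_idPl _); lia.
- have {hW1 hW2 hW3} hW := hW2 hda.
  have -> : m' = (4 * q - 2 * m)%N by rewrite /m' Em; lia.
  rewrite Em (maxn_idPl _); lia.
(* Here [m = q]. The leading terms of [N^2 - e t^2 D^2] may cancel, so [sW] is only bounded above;
   the bound already forces [m'] up to its ceiling [2q]. *)
- have {hW1 hW2 hW3} hW := hW3 (esym hda).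
  have -> : m' = (2 * m)%N by rewrite /m' Em; lia.
  rewrite Em (maxn_idPl _); lia.
Qed.

Lemma size_mul_pred (K : fieldType) (p q : {poly K}) : p != 0 -> q != 0 ->
  (size (p * q)).-1 = ((size p).-1 + (size q).-1)%N.
Proof.
move=> p0 q0; rewrite size_mul //; move: p0 q0; rewrite -!size_poly_gt0.
by move: (size p) (size q); clear=> [[|a] [|b]] //=; rewrite addnS.
Qed.

Section Height.
Variables (F : finFieldType) (R : realFieldType) (c : F).
Local Notation q := #|F|.
Local Notation e := ((c ^+ 2)%:P).
(* Locked, since unification would otherwise unfold t to a sum. *)
Definition tpoly : {poly F} := locked ('X^q - 'X).
Lemma tpolyE : tpoly = 'X^q - 'X. Proof. by rewrite /tpoly -lock. Qed.
Local Notation t := tpoly.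
Local Notation P := (t ^+ 2 - e).

Definition deg (p : {poly F}) : nat := (size p).-1.

(** The contribution [i (n - i) / n] of a fibre of type I_n met in component [i], for [n = 4q]. *)
Definition contr_inf (n : nat) : R := n%:R * (4%:R * q%:R - n%:R) / (4%:R * q%:R).

(* For D != 0 the first term is 2 chi + 2 (Q.O); the others are the contributions of I_{4q} at
   infinity, of the I_4 fibres (3/4 for a simple zero of N, 1 for a multiple one) and of the I_2
   fibres.  Sizes are degrees plus 1. *)
Definition xheight (N D : {poly F}) : R :=
  ((maxn (size D + 2 * q) (size N)).-1)%:R
  - contr_inf (minn (2 * q) (2 * q + size D - size N))
  - (deg (gcdp N t))%:R / 2%:R - (deg (gcdp N (t ^+ 2)))%:R / 4%:R
  - (deg (gcdp (N + e * D) P))%:R / 2%:R.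

Lemma q_gt1 : (1 < q)%N. Proof. exact: finNzRing_gt1. Qed.

Lemma size_t : size t = q.+1.
Proof. by rewrite tpolyE size_polyDl size_polyXn // size_polyN size_polyX ltnS q_gt1. Qed.

Lemma t_neq0 : t != 0. Proof. by rewrite -size_poly_gt0 size_t. Qed.

Lemma size_t2 : size (t ^+ 2) = (2 * q).+1.
Proof.
have := size_exp t 2; rewrite size_t /= mulnC => <-.
by rewrite prednK // size_poly_gt0 expf_neq0 // t_neq0.
Qed.

Lemma size_P : size P = (2 * q).+1.
Proof.
rewrite size_polyDl size_t2 // size_polyN (leq_ltn_trans (size_polyC_leq1 _)) //.
by rewrite ltnS muln_gt0 (ltnW q_gt1).
Qed.

Lemma P_neq0 : P != 0. Proof. by rewrite -size_poly_gt0 size_P. Qed.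

Lemma natr_cardF : q%:R = 0 :> F.
Proof.
(* The order of 1 in the additive group of [F] divides [q]. *)
have := @order_dvdG _ [set: F]%G (GRing.one F) (finset.in_setT _).
by rewrite order_dvdn cardsT FinRing.zmodXgE => /eqP.
Qed.

Lemma deriv_t : t^`() = -1.
Proof.
rewrite tpolyE derivB derivXn derivX -mulr_natr -polyC_natr natr_cardF.
by rewrite polyC0 mulr0 sub0r.
Qed.

Lemma degM (p r : {poly F}) : p != 0 -> r != 0 -> deg (p * r) = (deg p + deg r)%N.
Proof. exact: size_mul_pred. Qed.

Lemma degXn (p : {poly F}) n : deg (p ^+ n) = (n * deg p)%N.
Proof. by rewrite /deg size_exp mulnC. Qed.

Lemma deg_eqp (p r : {poly F}) : p %= r -> deg p = deg r.
Proof. by rewrite /deg => /eqp_size ->. Qed.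

(** For [f(m) = m (4q - m) / (4q)] one has [f(2m) = 4 f(m) - 2m], and [f] is invariant under
    [m -> 4q - m]. The defect [2m] matches the one in [size_dbl_max]. *)
Lemma contr_inf_dbl m m' : (m' = 2 * m \/ m' + 2 * m = 4 * q)%N ->
  contr_inf m' + (2 * m)%:R = 4%:R * contr_inf m.
Proof.
have q0 : q%:R != 0 :> R by rewrite pnatr_eq0 -lt0n (ltnW q_gt1).
rewrite /contr_inf => -[->|/(congr1 (fun n => n%:R : R))]; first by rewrite !natrM; field.
by rewrite natrD !natrM => /(canRL (addrK _)) ->; field.
Qed.

Section Doubling.
Hypotheses (two0 : 2%:R != 0 :> F) (c0 : c != 0).

Let e0 : e != 0. Proof. by rewrite polyC_eq0 expf_neq0. Qed.

Lemma size_dbl_max (N D : {poly F}) : N != 0 -> D != 0 ->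
  dbl_num e t N D != 0 -> dbl_den e t N D != 0 ->
  let m := minn (2 * q) (2 * q + size D - size N) in
  let m' := minn (2 * q) (2 * q + size (dbl_den e t N D) - size (dbl_num e t N D)) in
  ((maxn (size (dbl_den e t N D) + 2 * q) (size (dbl_num e t N D))).-1 + 2 * m
     = 4 * (maxn (size D + 2 * q) (size N)).-1)%N /\
  (m' = 2 * m \/ m' + 2 * m = 4 * q)%N.
Proof.
move=> Nn0 Dn0 N0 D0.
have [_ _ E0 M0] := dbl_den_neq0 D0.
have W0 : N ^+ 2 - e * t ^+ 2 * D ^+ 2 != 0 by move: N0; rewrite /dbl_num sqrf_eq0.
have four0 : 4%:R != 0 :> F by rewrite (natrM _ 2 2) mulf_neq0.
have sX2 (p : {poly F}) : p != 0 -> size (p ^+ 2) = (2 * size p - 1)%N.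
  by move=> p0; rewrite expr2 size_mul // subn1 mul2n addnn.
have sN2 := sX2 _ Nn0.
have sA : size (- (e * t ^+ 2 * D ^+ 2)) = (2 * q + 2 * size D - 1)%N.
  have D2 : D ^+ 2 != 0 by rewrite expf_neq0.
  have t2 : t ^+ 2 != 0 by rewrite expf_neq0 // t_neq0.
  rewrite size_polyN -mulrA size_Cmul ?expf_neq0 // size_mul // size_t2 sX2 //.
  move: Dn0; rewrite -size_poly_gt0; move: (size D) (q); clear=> a b; lia.
have eD : size (e * D) = size D by rewrite size_Cmul ?expf_neq0.
have tD : size (t ^+ 2 * D) = (2 * q + size D)%N.
  rewrite size_mul // ?expf_neq0 ?t_neq0 // size_t2.
  move: Dn0; rewrite -size_poly_gt0; move: (size D) (q); clear=> a b; lia.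
have sD0 : size (dbl_den e t N D)
    = (size N + size D + size (N + e * D)%R + size (N + t ^+ 2 * D)%R - 3)%N.
  rewrite /dbl_den -polyC_natr !size_mul ?mulf_neq0 ?polyC_eq0 // size_polyC four0.
  move: Nn0 Dn0 E0 M0; rewrite -!size_poly_gt0.
  move: (size (N + _)) (size (N + _)) (size N) (size D); clear=> n1 n2 n3 n4; lia.
have sN0 := sX2 _ W0.
have q0 := ltnW q_gt1.
apply: (valuation_infinity_dbl (sW := size (N ^+ 2 - e * t ^+ 2 * D ^+ 2)%R) (sE := size (N + e * D)%R)
  (sM := size (N + t ^+ 2 * D)%R)) => //; rewrite ?size_poly_gt0 //.
- move=> lt_a; rewrite size_polyDl ?sN2 // sA.
  by move: lt_a; move: (size N) (size D) (q); clear=> a d n; lia.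
- move=> lt_a; rewrite addrC size_polyDl ?sA // sN2.
  by move: lt_a q0; move: (size N) (size D) (q); clear=> a d n; lia.
- move=> eq_a; apply: leq_trans (size_polyD _ _) _; rewrite sN2 sA eq_a.
  by move: (size D) (q); clear=> d n; lia.
- by move=> lt_a; rewrite size_polyDl ?eD.
- by move=> le_a; apply: leq_trans (size_polyD _ _) _; rewrite eD geq_max le_a leqnn.
- by move=> lt_a; rewrite addrC size_polyDl ?tD.
- by move=> le_a; apply: leq_trans (size_polyD _ _) _; rewrite tD geq_max le_a leqnn.
Qed.

Definition dbl_num_red (N D : {poly F}) := dbl_num e t N D %/ gcdp (dbl_num e t N D) (dbl_den e t N D).
Definition dbl_den_red (N D : {poly F}) := dbl_den e t N D %/ gcdp (dbl_num e t N D) (dbl_den e t N D).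

(** No single term scales by 4, but the errors cancel. The defect [2m] of the degree is that of
    [contr_inf]. Reduction to lowest terms keeps the component at infinity and lowers the degree by
    [2 deg gcd(N, t^2) + 2 deg gcd(N + e D, P)], which the change of the finite fibre terms makes up
    for. *)
Lemma xheight_dbl (N D : {poly F}) : coprimep N D ->
  dbl_num e t N D != 0 -> dbl_den e t N D != 0 ->
  xheight (dbl_num_red N D) (dbl_den_red N D) = 4%:R * xheight N D.
Proof.
move=> coND N0 D0.
have [Nn0 Dn0 E0 _] := dbl_den_neq0 D0.
have [eqG eqt eqt2 coP] := gcd_dbl two0 c0 coND N0 D0 deriv_t.
have [hM hm] := size_dbl_max Nn0 Dn0 N0 D0.
have NE : dbl_num_red N D * gcdp (dbl_num e t N D) (dbl_den e t N D) = dbl_num e t N D.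
  by rewrite divpK ?dvdp_gcdl.
have DE : dbl_den_red N D * gcdp (dbl_num e t N D) (dbl_den e t N D) = dbl_den e t N D.
  by rewrite divpK ?dvdp_gcdr.
have G0 : gcdp (dbl_num e t N D) (dbl_den e t N D) != 0 by rewrite gcdp_eq0 negb_and N0.
have N'0 : dbl_num_red N D != 0 by apply: contraNneq N0 => Z; rewrite -NE Z mul0r.
have D'0 : dbl_den_red N D != 0 by apply: contraNneq D0 => Z; rewrite -DE Z mul0r.
have gt0 : gcdp N t != 0 by rewrite gcdp_eq0 negb_and Nn0.
have gt20 : gcdp N (t ^+ 2) != 0 by rewrite gcdp_eq0 negb_and Nn0.
have gP0 : gcdp (N + e * D) P != 0 by rewrite gcdp_eq0 negb_and E0.
have gt0' : gcdp (dbl_num_red N D) t != 0 by rewrite gcdp_eq0 negb_and N'0.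
have sN' : size (dbl_num e t N D) = (size (dbl_num_red N D) + deg (gcdp (dbl_num e t N D) (dbl_den e t N D)))%N.
  rewrite -{1}NE size_mul // /deg; move: G0; rewrite -size_poly_gt0.
  by move: (size (dbl_num_red N D)) (size (gcdp _ _)); clear=> a b; lia.
have sD' : size (dbl_den e t N D) = (size (dbl_den_red N D) + deg (gcdp (dbl_num e t N D) (dbl_den e t N D)))%N.
  rewrite -{1}DE size_mul // /deg; move: G0; rewrite -size_poly_gt0.
  by move: (size (dbl_den_red N D)) (size (gcdp _ _)); clear=> a b; lia.
have := deg_eqp eqG; rewrite degM ?expf_neq0 // !degXn => dG.
have := deg_eqp eqt; rewrite degM // degXn => dt.
have := deg_eqp eqt2; rewrite degXn => dt2.
have dP : deg (gcdp (dbl_num_red N D + e * dbl_den_red N D) P) = 0%N.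
  by apply/eqP; rewrite /deg -subn1 subn_eq0; move: coP; rewrite /coprimep => /eqP ->.
have E1 : (maxn (size (dbl_den e t N D) + 2 * q) (size (dbl_num e t N D))).-1
  = ((maxn (size (dbl_den_red N D) + 2 * q) (size (dbl_num_red N D))).-1
    + deg (gcdp (dbl_num e t N D) (dbl_den e t N D)))%N.
  rewrite sN' sD'; move: D'0; rewrite -size_poly_gt0.
  by move: (size (dbl_num_red N D)) (size (dbl_den_red N D)) (deg _) (q); clear=> *; lia.
have E2 : minn (2 * q) (2 * q + size (dbl_den e t N D) - size (dbl_num e t N D))
  = minn (2 * q) (2 * q + size (dbl_den_red N D) - size (dbl_num_red N D)).
  by rewrite sN' sD' addnA subnDr.
have natE (m n : nat) : m = n -> m%:R = n%:R :> R by move->.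
rewrite E2 in hm; have := contr_inf_dbl hm; rewrite natrM => hc.
move: hM; rewrite E1 dG => /natE; rewrite !(natrM, natrD) => hM.
move: dt => /natE; rewrite !(natrM, natrD) => dt.
move: dt2 => /natE; rewrite natrM => dt2.
by rewrite /xheight dP dt2; lra.
Qed.

Lemma xheight_scale (n : {poly F}) (d : F) : d != 0 ->
  xheight (d *: n) d%:P = xheight n 1.
Proof.
move=> d0.
have E : d *: n + e * d%:P = d *: (n + e * 1) by rewrite -!mul_polyC; ring.
rewrite /xheight E size_polyC d0 size_poly1 size_scale //.
have g (a p : {poly F}) : deg (gcdp (d *: a) p) = deg (gcdp a p).
  by apply/deg_eqp/eqp_gcdl/eqp_scale.
by rewrite !g.
Qed.

Let q0 : q%:R != 0 :> R. Proof. by rewrite pnatr_eq0 -lt0n (ltnW q_gt1). Qed.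

Let xheight1 (n : {poly F}) (m d1 d2 d3 : nat) : (size n <= (2 * q).+1)%N ->
  minn (2 * q) (2 * q + 1 - size n) = m -> deg (gcdp n t) = d1 -> deg (gcdp n (t ^+ 2)) = d2 ->
  deg (gcdp (n + e) P) = d3 ->
  xheight n 1 = 2%:R * q%:R - contr_inf m - d1%:R / 2%:R - d2%:R / 4%:R - d3%:R / 2%:R.
Proof.
move=> hn hm h1 h2 h3; rewrite /xheight mulr1 h1 h2 h3 size_poly1 hm.
by rewrite add1n (maxn_idPl hn) natrM.
Qed.

Let deg_t : deg t = q. Proof. by rewrite /deg size_t. Qed.
Let deg_t2 : deg (t ^+ 2) = (2 * q)%N. Proof. by rewrite /deg size_t2. Qed.
Let deg_P : deg P = (2 * q)%N. Proof. by rewrite /deg size_P. Qed.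

Let deg_gcd_dvdl (u v : {poly F}) : u %| v -> deg (gcdp u v) = deg u.
Proof. by move=> uv; apply/deg_eqp/dvdp_gcd_idl. Qed.

Let deg_gcd_dvdr (u v : {poly F}) : v %| u -> deg (gcdp u v) = deg v.
Proof. by move=> uv; apply/deg_eqp/dvdp_gcd_idr. Qed.

Let deg_gcd_const (a : F) p : a != 0 -> deg (gcdp a%:P p) = 0%N.
Proof.
move=> a0; rewrite deg_gcd_dvdl ?/deg ?size_polyC ?a0 //.
have /eqp_dvdl -> : a%:P %= 1; last exact: dvd1p.
by rewrite -size_poly_eq1 size_polyC a0.
Qed.

(** The conventions for the zero polynomial (size 0, gcd equal to the other argument) encode the
    right components of [(0, 0)]: [2q] at infinity and 2 over each zero of [t]. *)
Lemma xheight_torsion0 : xheight 0 1 = 0.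
Proof.
rewrite (@xheight1 0 (2 * q) q (2 * q) 0) ?size_poly0 ?gcd0p // ?add0r ?deg_gcd_const ?expf_neq0 //; last first.
  by apply/minn_idPl; rewrite subn0 leq_addr.
by rewrite /contr_inf natrM; field.
Qed.

Lemma xheight_torsion_e : xheight (- e) 1 = 0.
Proof.
have se : size (- e) = 1%N by rewrite size_polyN size_polyC expf_neq0.
rewrite (@xheight1 (- e) (2 * q) 0 0 (2 * q)) ?se ?addnK ?minnn //.
- by rewrite /contr_inf natrM; field.
- by rewrite -polyCN deg_gcd_const // oppr_eq0 expf_neq0.
- by rewrite -polyCN deg_gcd_const // oppr_eq0 expf_neq0.
- by rewrite addNr gcd0p.
Qed.

Lemma xheight_torsion_t : xheight (- t ^+ 2) 1 = 0.
Proof.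
have st : size (- t ^+ 2) = (2 * q).+1 by rewrite size_polyN size_t2.
rewrite (@xheight1 (- t ^+ 2) 0 q (2 * q) (2 * q)) ?st ?addn1 ?subnn ?minn0 //.
- by rewrite /contr_inf natrM; field.
- by rewrite deg_gcd_dvdr ?deg_t // dvdpNr dvdp_exp.
- by rewrite deg_gcd_dvdr ?deg_t2 // dvdpNr.
- by rewrite deg_gcd_dvdr ?deg_P // -dvdpNr opprD opprK.
Qed.

(** These are the x-coordinates of the points of order 4 whose double is [(0, 0)]; the terms are
    [2q - 3q/4 - q/2 - q/4 - q/2]. *)
Lemma xheight_torsion_ct (a : F) : a ^+ 2 = c ^+ 2 -> xheight (a *: t) 1 = 0.
Proof.
move=> a2; have a0 : a != 0 by rewrite -sqrf_eq0 a2 expf_neq0.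
have st : size (a *: t) = q.+1 by rewrite size_scale // size_t.
have tE : a *: t + e = a *: (t + a%:P).
  by rewrite -!mul_polyC -a2 polyC_exp; ring.
have PE : P = (t + a%:P) * (t - a%:P) by rewrite -a2 polyC_exp; ring.
have sa : size (t + a%:P) = q.+1.
  by rewrite size_polyDl size_t // ltnS (leq_trans (size_polyC_leq1 _)) // (ltnW q_gt1).
have dvd_deg (u v : {poly F}) : u %| v -> deg (gcdp (a *: u) v) = deg u.
  move=> uv; rewrite deg_gcd_dvdl ?dvdpZl // /deg size_scale //.
rewrite (@xheight1 (a *: t) q q q q) ?st ?tE ?dvd_deg //.
- by rewrite /contr_inf; field.
- by rewrite ltnS leq_pmull.
- by rewrite addn1 subSS mul2n -addnn addnK; apply/minn_idPr; rewrite leq_addr.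
- by rewrite dvdp_exp.
- by rewrite /deg sa.
- by rewrite PE dvdp_mulr.
Qed.

End Doubling.
End Height.

(** * Chord-tangent algebra and degrees of rational functions *)

Section Curve.
Variables (K : fieldType) (a2 a4 : K).
Hypothesis two0 : 2%:R != 0 :> K.
Definition on_curve (x y : K) := y ^+ 2 = x ^+ 3 + a2 * x ^+ 2 + a4 * x.

Lemma tangent_third (x y l x3 : K) : on_curve x y -> y != 0 ->
  l = (3%:R * x ^+ 2 + 2%:R * a2 * x + a4) / (2%:R * y) -> x3 = l ^+ 2 - a2 - x - x ->
  on_curve x3 (- (l * (x3 - x) + y)) /\ x3 = (x ^+ 2 - a4) ^+ 2 / (4%:R * y ^+ 2).
Proof.
move=> xy y0 El Ex3.
have hl : 2%:R * l * y = 3%:R * x ^+ 2 + 2%:R * a2 * x + a4 by rewrite El; field; rewrite ?y0 ?two0.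
have four0 : 4%:R != 0 :> K by rewrite (natrM _ 2 2) mulf_neq0.
split.
  rewrite /on_curve; transitivity (l ^+ 2 * (x3 - x) ^+ 2 + (2%:R * l * y) * (x3 - x) + y ^+ 2).
    by ring.
  by rewrite hl xy Ex3; ring.
apply: (mulIf (_ : 4%:R * y ^+ 2 != 0)); rewrite ?mulf_neq0 // mulfVK ?mulf_neq0 //.
transitivity ((2%:R * l * y) ^+ 2 - 4%:R * y ^+ 2 * (a2 + x + x)); first by rewrite Ex3; ring.
by rewrite hl xy; ring.
Qed.

(** The cubic has no constant term, so by Vieta the three x-coordinates on a line multiply to the
    square of its intercept, which is [(x1 y2 - x2 y1) / (x1 - x2)] up to sign. *)
Lemma secant_third (x1 y1 x2 y2 l x3 : K) : on_curve x1 y1 -> on_curve x2 y2 -> x1 != x2 ->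
  l = (y2 - y1) / (x2 - x1) -> x3 = l ^+ 2 - a2 - x1 - x2 ->
  on_curve x3 (- (l * (x3 - x1) + y1)) /\
  x3 * (x1 * x2) * (x1 - x2) ^+ 2 = (x1 * y2 - x2 * y1) ^+ 2.
Proof.
move=> xy1 xy2 x12 El Ex3.
have d0 : x2 - x1 != 0 by rewrite subr_eq0 eq_sym.
have hl : y2 = y1 + l * (x2 - x1) by rewrite El divfK // addrC subrK.
have hl2 : 2%:R * l * y1 = x2 ^+ 2 + x1 * x2 + x1 ^+ 2 + a2 * (x1 + x2) + a4 - l ^+ 2 * (x2 - x1).
  apply: (mulIf d0); apply/eqP; rewrite -subr_eq0; apply/eqP.
  transitivity ((y2 ^+ 2 - y1 ^+ 2) - (x2 ^+ 3 + a2 * x2 ^+ 2 + a4 * x2)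
    + (x1 ^+ 3 + a2 * x1 ^+ 2 + a4 * x1)); first by rewrite hl; ring.
  by rewrite xy1 xy2; ring.
split.
  rewrite /on_curve; transitivity (l ^+ 2 * (x3 - x1) ^+ 2 + (2%:R * l * y1) * (x3 - x1) + y1 ^+ 2).
    by ring.
  by rewrite hl2 xy1 Ex3; ring.
have hx3 : x3 * (x1 - x2) ^+ 2 = (y2 - y1) ^+ 2 - (a2 + x1 + x2) * (x1 - x2) ^+ 2.
  by rewrite Ex3 hl; ring.
rewrite mulrAC hx3; apply/eqP; rewrite -subr_eq0; apply/eqP.
transitivity ((x1 - x2) * (x2 * y1 ^+ 2 - x1 * y2 ^+ 2)
  - x1 * x2 * (a2 + x1 + x2) * (x1 - x2) ^+ 2); first by ring.
by rewrite xy1 xy2; ring.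
Qed.

Lemma dbl_homogeneous (n d e t : K) : d != 0 ->
  ((n / d) ^+ 2 - e * t ^+ 2) ^+ 2 = (n ^+ 2 - e * t ^+ 2 * d ^+ 2) ^+ 2 / d ^+ 4 /\
  4%:R * (n / d * (n / d + e) * (n / d + t ^+ 2)) =
    4%:R * n * d * (n + e * d) * (n + t ^+ 2 * d) / d ^+ 4.
Proof. by move=> d0; split; field. Qed.

Lemma frac_cancel (n d g m n0 d0 : K) : g != 0 -> m != 0 -> d != 0 -> n * g = n0 -> d * g = d0 ->
  n0 / m / (d0 / m) = n / d.
Proof. by move=> g0 m0 dn0 <- <-; field; rewrite ?dn0 ?g0 ?m0. Qed.

End Curve.

Section Rational.
Variable F : finFieldType.
Local Notation K := (Kq F).
Local Notation tof := (@FracField.tofrac {poly F}).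

Lemma frac_repr (x : K) : x = tof (frac (repr x)).1 / tof (frac (repr x)).2.
Proof.
have d0 : (frac (repr x)).2 != 0 by exact: denom_ratioP.
apply: (mulIf (_ : tof (frac (repr x)).2 != 0)); rewrite ?tofrac_eq0 // mulfVK ?tofrac_eq0 //.
move: (repr x) (reprK x) d0 => [[n d] /= nd] Ex _.
rewrite -{}Ex !piE; apply/eqmodP; rewrite /= FracField.equivfE /FracField.mulf.
by rewrite !numden_Ratio ?oner_neq0 ?mulr1 //= ?mulf_neq0 ?oner_neq0 //= mulrC.
Qed.

Lemma rdegE (N D : {poly F}) : D != 0 -> coprimep N D ->
  rdeg (tof N / tof D) = (maxn (size N) (size D)).-1.
Proof.
move=> D0 co; rewrite /rdeg; set r := repr _.
have d0 : (frac r).2 != 0 by exact: denom_ratioP.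
have := frac_repr (tof N / tof D); rewrite -/r; move: ((frac r).1) ((frac r).2) d0 => n d d0.
move/eqP; rewrite eqr_div ?tofrac_eq0 // -!tofracM tofrac_eq => /eqP E.
have g0 : gcdp n d != 0 by rewrite gcdp_eq0 negb_and d0 orbT.
set n' := n %/ _; set d' := d %/ _.
have co' : coprimep n' d' by rewrite coprimep_div_gcd // d0 orbT.
have {}E : N * d' = n' * D.
  apply: (mulIf g0); rewrite -mulrA divpK ?dvdp_gcdr // E [RHS]mulrAC divpK ?dvdp_gcdl //.
have /eqp_size -> : n' %= N.
  rewrite /eqp -(Gauss_dvdpl N co') -(Gauss_dvdpl n' co) E dvdp_mulIl /=.
  by rewrite -E dvdp_mulIl.
have /eqp_size -> // : d' %= D.
have co'2 : coprimep d' n' by rewrite coprimep_sym.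
have co2 : coprimep D N by rewrite coprimep_sym.
by rewrite /eqp -(Gauss_dvdpr D co'2) -(Gauss_dvdpr d' co2) E dvdp_mulIr /= -E dvdp_mulIr.
Qed.

End Rational.

(** * The canonical height is the sum of local heights *)

Section CanonicalHeight.
Variables (F : finFieldType) (R : realType) (b : F).
Local Notation K := (Kq F).
Local Notation q := #|F|.
Local Notation tof := (@FracField.tofrac {poly F}).
Local Notation t := (tpoly F).
Local Notation c := (4%:R * b).
Local Notation e := ((c ^+ 2)%:P).
Local Notation P := (t ^+ 2 - e).
Local Notation height := (xheight R c).
Hypotheses (two0 : 2%:R != 0 :> F) (b0 : b != 0).

Let c0 : c != 0. Proof. by rewrite mulf_neq0 // (natrM _ 2 2) mulf_neq0. Qed.

Lemma tofrac_nat n : tof n%:R = n%:R :> K.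
Proof. exact: rmorph_nat. Qed.

Let two0K : 2%:R != 0 :> K.
Proof. by rewrite -(rmorph_nat tof) tofrac_eq0 -polyC_natr polyC_eq0. Qed.

Let four0F : 4%:R != 0 :> F. Proof. by rewrite (natrM _ 2 2) mulf_neq0. Qed.

Let four0K : 4%:R != 0 :> K.
Proof. by rewrite -(rmorph_nat tof) tofrac_eq0 -polyC_natr polyC_eq0. Qed.

Lemma tKE : tK F = tof t.
Proof. by rewrite /tK /uK tpolyE -tofracXn -tofracB. Qed.

Lemma cK16E : cK (16%:R * b ^+ 2) = tof e.
Proof. by rewrite /cK; congr (tof _%:P); ring. Qed.

Lemma EaE : Ea2 b = tof (e + t ^+ 2) /\ Ea4 b = tof (e * t ^+ 2).
Proof. by rewrite /Ea2 /Ea4 cK16E tKE tofracD tofracXn tofracM tofracXn. Qed.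

Local Notation on_E := (on_curve (Ea2 b) (Ea4 b)).

Lemma on_E_factor x y : on_E x y <-> y ^+ 2 = x * (x + tof e) * (x + tof t ^+ 2).
Proof.
have [-> ->] := EaE; rewrite /on_curve tofracD tofracXn tofracM tofracXn.
by split=> ->; ring.
Qed.

(** A relation, since a representation in lowest terms is only unique up to a scalar. The curve
    equation is carried along because the duplication formula in [x] alone depends on it. *)
Definition has_height (Q : pt F) (h : R) : Prop :=
  if Q is Some (x, y) then
    on_E x y /\ exists N D, [/\ coprimep N D, D != 0, x = tof N / tof D & height N D = h]
  else h = 0.

(* 2Q = O or 2Q = (0, 0): torsion points, where valuations of zero polynomials would be junk. *)
Lemma xheight_torsion (N D : {poly F}) : coprimep N D -> D != 0 ->
  dbl_num e t N D = 0 \/ dbl_den e t N D = 0 -> height N D = 0.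
Proof.
move=> co D0.
(* When [x] is a polynomial [n], coprimality of [n * D] and [D] makes [D] a nonzero constant. *)
have red n : N = n * D -> height n 1 = 0 -> height N D = 0.
  move=> EN hn; have : size D == 1%N.
    by rewrite -coprimepp; move: co; rewrite EN coprimepMl => /andP [].
  move=> /size_poly1P [d d0 ED].
  by rewrite EN ED [n * _]mulrC mul_polyC xheight_scale.
rewrite /dbl_num /dbl_den; case=> /eqP.
  rewrite sqrf_eq0 => W.
  have : (N - (c *: t) * D) * (N - (- c *: t) * D) == 0.
    by rewrite -(eqP W) -!mul_polyC polyCN polyC_exp; apply/eqP; ring.
  rewrite mulf_eq0 !subr_eq0 => /orP [] /eqP EN; apply: (red _ EN).
    exact: xheight_torsion_ct.
  by apply: xheight_torsion_ct => //; rewrite sqrrN.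
rewrite !mulf_eq0 (negPf D0) -[4%:R]polyC_natr polyC_eq0 (negPf four0F) /= orbF.
rewrite -orbA => /or3P [] /eqP EN.
- by apply: (red 0); rewrite ?EN ?mul0r ?xheight_torsion0.
- apply: (red (- e)); last exact: xheight_torsion_e.
  by rewrite mulNr; apply/eqP; rewrite -addr_eq0 EN.
- apply: (red (- t ^+ 2)); last exact: xheight_torsion_t.
  by rewrite mulNr; apply/eqP; rewrite -addr_eq0 EN.
Qed.

Lemma has_height_dbl Q h : has_height Q h -> has_height (Eadd b Q Q) (4%:R * h).
Proof.
case: Q => [[x y]|] /=; last by move=> ->; rewrite mulr0.
move=> [xy [N [D [co D0 Ex hh]]]]; rewrite /Eadd /= eqxx /=.
have tD0 : tof D != 0 by rewrite tofrac_eq0.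
have [hx hy] := dbl_homogeneous (tof N) (tof e) (tof t) tD0.
have tN0 : tof (dbl_num e t N D) = (tof N ^+ 2 - tof e * tof t ^+ 2 * tof D ^+ 2) ^+ 2.
  by rewrite /dbl_num !(tofracXn, tofracM, tofracB).
have tD0' : tof (dbl_den e t N D)
    = 4%:R * tof N * tof D * (tof N + tof e * tof D) * (tof N + tof t ^+ 2 * tof D).
  by rewrite /dbl_den !(tofracXn, tofracM) tofrac_nat !tofracD !(tofracXn, tofracM).
have y2 : 4%:R * y ^+ 2 = tof (dbl_den e t N D) / tof D ^+ 4.
  by move/on_E_factor: xy => ->; rewrite Ex tD0' hy.
have x2 : (x ^+ 2 - Ea4 b) ^+ 2 = tof (dbl_num e t N D) / tof D ^+ 4.
  by rewrite Ex (EaE).2 tofracM tofracXn hx tN0.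
have D4 : tof D ^+ 4 != 0 := expf_neq0 4 tD0.
have y2E : (4%:R * y ^+ 2 == 0) = (dbl_den e t N D == 0).
  by rewrite y2 mulf_eq0 invr_eq0 (negPf D4) orbF tofrac_eq0.
have y2E' : (4%:R * y ^+ 2 == 0) = (y == 0) by rewrite mulf_eq0 (negPf four0K) sqrf_eq0.
have [y0|y0] := eqVneq y 0.
  have dbl0 : dbl_den e t N D = 0 by apply/eqP; rewrite -y2E y2E' y0 eqxx.
  by rewrite y0 oppr0 eqxx /= -hh xheight_torsion ?mulr0 //; right.
have -> : (y == - y) = false.
  by rewrite -subr_eq0 opprK -mulr2n -mulr_natl mulf_eq0 (negPf two0K) (negPf y0).
have D'0 : dbl_den e t N D != 0 by rewrite -y2E y2E' (negPf y0).
have [on3 Ex3] := tangent_third two0K xy y0 erefl erefl.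
split=> //; rewrite {}Ex3 y2 x2.
(* A zero numerator means [2Q = (0, 0)], represented by [0 / 1]. *)
have [N'0|N'0] := eqVneq (dbl_num e t N D) 0.
  exists 0, 1; rewrite coprimep1 oner_neq0 N'0 tofrac0 !mul0r; split=> //.
  by rewrite xheight_torsion0 // -hh xheight_torsion ?mulr0 //; left.
have EN := divpK (dvdp_gcdl (dbl_num e t N D) (dbl_den e t N D)).
have ED := divpK (dvdp_gcdr (dbl_num e t N D) (dbl_den e t N D)).
have sD0 : dbl_den_red c N D != 0.
  by apply: contraNneq D'0 => Z; rewrite -ED -/(dbl_den_red c N D) Z mul0r.
have G0 : gcdp (dbl_num e t N D) (dbl_den e t N D) != 0 by rewrite gcdp_eq0 negb_and N'0.
exists (dbl_num_red c N D), (dbl_den_red c N D); split=> //.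
- exact: coprime_dbl_red.
- apply: (@frac_cancel _ _ _ (tof (gcdp (dbl_num e t N D) (dbl_den e t N D)))).
  + by rewrite tofrac_eq0.
  + exact: D4.
  + by rewrite tofrac_eq0.
  + by rewrite -tofracM EN.
  + by rewrite -tofracM ED.
- by rewrite xheight_dbl // hh.
Qed.

(** Only uniformity in the point matters. The degree terms differ by at most [2q], in the direction
    that offsets the fibre terms, which are at most [2q] (a coarse bound at infinity), [q/2], [q/2]
    and [q]. *)
Lemma xheight_naive (N D : {poly F}) : D != 0 ->
  `|(maxn (size N) (size D)).-1%:R - height N D| <= 4%:R * q%:R.
Proof.
move=> D0; rewrite /xheight.
have q1 : (1 < q)%N := q_gt1 F.
have q0 : (0 : R) < q%:R by rewrite ltr0n ltnW.
have dle (p r : {poly F}) : r != 0 -> (deg (gcdp p r) <= deg r)%N.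
  by move=> r0; rewrite /deg -!subn1 leq_sub2r // leq_gcdpr.
have d1 : (deg (gcdp N t))%:R <= q%:R :> R.
  by rewrite ler_nat (leq_trans (dle _ _ (t_neq0 F))) // /deg size_t.
have d2 : (deg (gcdp N (t ^+ 2)))%:R <= 2%:R * q%:R :> R.
  by rewrite -natrM ler_nat (leq_trans (dle _ _ _)) ?expf_neq0 ?t_neq0 // /deg size_t2.
have d3 : (deg (gcdp (N + e * D) P))%:R <= 2%:R * q%:R :> R.
  by rewrite -natrM ler_nat (leq_trans (dle _ _ _)) ?P_neq0 // /deg size_P.
have : (minn (2 * q) (2 * q + size D - size N))%:R <= 2%:R * q%:R :> R.
  by rewrite -natrM ler_nat geq_minl.
move: (minn _ _) => m m2.
have [c1 c2] : 0 <= contr_inf F R m /\ contr_inf F R m <= 2%:R * q%:R.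
  have m0 : (0 : R) <= m%:R by rewrite ler0n.
  rewrite /contr_inf; split; first by apply: divr_ge0; [apply: mulr_ge0; lra|lra].
  rewrite ler_pdivrMr; last lra.
  by nra.
have M1 : (maxn (size N) (size D)).-1%:R <= (maxn (size D + 2 * q) (size N)).-1%:R :> R.
  rewrite ler_nat; move: (size N) (size D) (q); clear=> n d k; lia.
have M2 : (maxn (size D + 2 * q) (size N)).-1%:R <= (maxn (size N) (size D)).-1%:R + 2%:R * q%:R :> R.
  rewrite -natrM -natrD ler_nat; move: D0; rewrite -size_poly_gt0.
  move: (size N) (size D) (q); clear=> n d k; lia.
have p1 : 0 <= (deg (gcdp N t))%:R :> R by rewrite ler0n.
have p2 : 0 <= (deg (gcdp N (t ^+ 2)))%:R :> R by rewrite ler0n.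
have p3 : 0 <= (deg (gcdp (N + e * D) P))%:R :> R by rewrite ler0n.
rewrite ler_norml; apply/andP; split; lra.
Qed.

Lemma naive_has_height Q h : has_height Q h -> `|(naive_h Q)%:R - h| <= 4%:R * q%:R.
Proof.
case: Q => [[x y]|] /=; last by move=> ->; rewrite subr0 normr0 mulr_ge0.
by move=> [_ [N [D [co D0 -> <-]]]]; rewrite rdegE //; apply: xheight_naive.
Qed.

Lemma has_height_iter Q h n : has_height Q h ->
  has_height (iter n (fun Q => Eadd b Q Q) Q) (4%:R ^+ n * h).
Proof.
move=> hQ; elim: n => [|n IH] /=; first by rewrite expr0 mul1r.
by rewrite exprS -mulrA; apply: has_height_dbl.
Qed.

Local Open Scope classical_set_scope.

(** Tate's argument: along [2^n Q] the quantity is exactly [4^n h], so the n-th term of the limit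
    differs from [h] by at most [4q / 4^n]. *)
Lemma hhatE Q h : has_height Q h -> hhat R b Q = h.
Proof.
move=> hQ; rewrite /hhat; apply: cvg_lim => //.
have four0 : 4%:R != 0 :> R by rewrite pnatr_eq0.
have bound n : `|(naive_h (iter n (fun Q => Eadd b Q Q) Q))%:R / 4%:R ^+ n - h|
    <= 4%:R * q%:R * (4%:R^-1) ^+ n :> R.
  have := naive_has_height (has_height_iter n hQ).
  have p4 : 0 < 4%:R ^+ n :> R by rewrite exprn_gt0.
  set a := _%:R; rewrite exprVn => H.
  have -> : a / 4%:R ^+ n - h = (a - 4%:R ^+ n * h) / 4%:R ^+ n.
    by rewrite mulrBl mulrAC divff ?mul1r // expf_neq0.
  by rewrite normrM normfV (gtr0_norm p4) ler_pM2r ?invr_gt0.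
have geo : (fun n => 4%:R * q%:R * (4%:R^-1) ^+ n : R) @ \oo --> (0 : R).
  rewrite -[X in _ --> X](mulr0 (4%:R * q%:R)); apply: cvgMr; apply: cvg_expr.
  by rewrite ger0_norm ?invr_ge0 // invf_lt1 // ltr1n.
have lo : (fun n => h - 4%:R * q%:R * (4%:R^-1) ^+ n : R) @ \oo --> h.
  by rewrite -[X in _ --> X](subr0 h); apply: cvgB => //; apply: cvg_cst.
have up : (fun n => h + 4%:R * q%:R * (4%:R^-1) ^+ n : R) @ \oo --> h.
  by rewrite -[X in _ --> X](addr0 h); apply: cvgD => //; apply: cvg_cst.
apply: squeeze_cvgr lo up; near=> n.
by have := bound n; rewrite ler_norml => /andP [h1 h2]; apply/andP; split; lra.
Unshelve. all: by end_near.
Qed.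

End CanonicalHeight.

(** * The quadratic character *)

Section QuadraticCharacter.
Variables (F : finFieldType) (R : realType) (k : nat).
Hypothesis qk : #|F| = k.*2.+1.
Local Notation chi := (qchi R).

Lemma expf_double (x : F) : x != 0 -> x ^+ k.*2 = 1.
Proof. by move=> x0; apply: (mulIf x0); rewrite mul1r -exprSr -qk expf_card. Qed.

Lemma card_half_gt0 : (0 < k)%N.
Proof. by have := q_gt1 F; rewrite qk; case: k. Qed.

Lemma prim_root_F : exists g : F, (k.*2).-primitive_root g.
Proof.
have k2 : (0 < k.*2)%N by rewrite double_gt0 card_half_gt0.
have /hasP [g _ pg] : has (k.*2).-primitive_root (enum [pred x : F | x != 0]).
  apply: has_prim_root => //.
  - apply/allP => x; rewrite mem_enum inE => x0.
    by rewrite unity_rootE expf_double.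
  - exact: enum_uniq.
  - by rewrite -cardE; have := cardC1 (0 : F); rewrite qk /= => <-.
by exists g.
Qed.

Lemma euler_criterion (x : F) : x != 0 -> [exists y : F, y ^+ 2 == x] = (x ^+ k == 1).
Proof.
move=> x0; have [g pg] := prim_root_F; apply/existsP/idP => [[y /eqP Ey]|/eqP xk].
  rewrite -Ey -exprM mul2n expf_double //; apply: contraNneq x0 => y0.
  by rewrite -Ey y0 expr0n.
have [[i /= _] Ei] := prim_rootP pg (expf_double x0).
have : (k.*2 %| i * k)%N by rewrite (prim_order_dvd pg) exprM -Ei xk.
rewrite -mul2n dvdn_pmul2r ?card_half_gt0 // => /dvdnP [j Ej].
by exists (g ^+ j); rewrite -exprM -Ej Ei.
Qed.

Lemma qchi0 : chi (0 : F) = 0. Proof. by rewrite /qchi eqxx. Qed.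

Lemma qchiE (x : F) : x != 0 -> chi x = if x ^+ k == 1 then 1 else -1.
Proof. by move=> x0; rewrite /qchi (negPf x0) euler_criterion. Qed.

Lemma qchi_exp (x : F) : x != 0 -> (x ^+ k == 1) || (x ^+ k == -1).
Proof. by move=> x0; rewrite -sqrf_eq1 -exprM muln2 expf_double. Qed.

Hypothesis two0 : 2%:R != 0 :> F.

Let m1 : (-1 == 1 :> F) = false.
Proof. by rewrite eq_sym -subr_eq0 opprK (negPf two0). Qed.

Lemma qchiM (x y : F) : chi (x * y) = chi x * chi y.
Proof.
have [->|x0] := eqVneq x 0; first by rewrite mul0r qchi0 mul0r.
have [->|y0] := eqVneq y 0; first by rewrite mulr0 qchi0 mulr0.
rewrite !qchiE ?mulf_neq0 // exprMn.
case/orP: (qchi_exp x0) => /eqP ->; case/orP: (qchi_exp y0) => /eqP ->;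
  by rewrite !(mulr1, mul1r, mulN1r, opprK, eqxx, m1) /= ?(mulr1, mul1r, mulN1r, opprK).
Qed.

Lemma qchi_sqr (x : F) : x != 0 -> chi (x ^+ 2) = 1.
Proof. by move=> x0; rewrite qchiE ?expf_neq0 // -exprM mul2n expf_double ?eqxx. Qed.

Lemma sum_qchi : \sum_(x : F) chi x = 0.
Proof.
have [g pg] := prim_root_F.
have k2 : (0 < k.*2)%N by rewrite double_gt0 card_half_gt0.
have g0 : g != 0.
  apply/eqP => g0; have := prim_expr_order pg; rewrite g0 expr0n (gtn_eqF k2).
  by move/eqP; rewrite eq_sym oner_eq0.
have cg : chi g = -1.
  rewrite qchiE //; case: eqP => // /eqP; rewrite -(prim_order_dvd pg) => /dvdn_leq.
  by rewrite card_half_gt0 => /(_ isT); rewrite -addnn leqNgt -{1}[k]addn0 ltn_add2l card_half_gt0.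
(* Multiplication by the non-square [g] permutes [F] and changes the sign of every term. *)
have E : \sum_(x : F) chi x = - \sum_(x : F) chi x.
  rewrite {1}(reindex_onto (fun x => g * x) (fun x => g^-1 * x)) /=; last first.
    by move=> x _; rewrite mulVKf.
  rewrite -sumrN; apply: eq_big => [x|x _]; first by rewrite mulKf ?eqxx.
  by rewrite qchiM cg mulN1r.
by move: E; set s := \sum_(x : F) _; clearbody s; move=> E; lra.
Qed.

Lemma sum_qchi_inj (f : F -> F) : injective f -> \sum_(x : F) chi (f x) = 0.
Proof. by move=> f_inj; rewrite -[RHS]sum_qchi [RHS](reindex_inj f_inj). Qed.

Lemma sum_qchi_diff_squares (c : F) : c != 0 ->
  \sum_(x : F) chi ((x - c) * (x + c)) = -1.
Proof.
(* Up to the square (x + c)^2, the argument is f x, and f is a bijection (with 0^-1 = 0) which takes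
   the value 1 at the excluded point - c. *)
move=> c0; pose f x : F := 1 - 2%:R * c * (x + c)^-1.
pose g x : F := (2%:R * c / (1 - x)) - c.
have c2 : 2%:R * c != 0 by rewrite mulf_neq0.
have fg : cancel f g.
  move=> x; rewrite /f /g subKr invfM invrK mulrA divff // mul1r addrK //.
have := sum_qchi_inj (can_inj fg); rewrite (bigD1 (- c)) //= {1}/f addNr invr0 mulr0 subr0.
have -> : chi (1 : F) = 1 by rewrite qchiE ?oner_eq0 // expr1n eqxx.
move=> /eqP; rewrite addrC addr_eq0 => /eqP <-.
rewrite [LHS](bigD1 (- c)) //= addNr mulr0 qchi0 add0r.
apply: eq_bigr => x xc; have xc0 : x + c != 0 by rewrite addr_eq0.
have -> : (x - c) * (x + c) = f x * (x + c) ^+ 2 by rewrite /f; field.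
by rewrite qchiM qchi_sqr // mulr1.
Qed.

(** This is the character sum for [gamma = 4b] or [-4b], where two of the four roots coincide. The
    square factor only removes the term at [x = 0], which is [chi(-1)]. *)
Lemma sum_qchi_double_root (c : F) : c != 0 ->
  \sum_(x : F) chi (x ^+ 2 * ((x - c) * (x + c))) = -1 - chi (-1 : F).
Proof.
move=> c0; have := sum_qchi_diff_squares c0.
rewrite (bigD1 0) //=; have -> : (0 - c) * (0 + c) = -1 * c ^+ 2 by ring.
rewrite qchiM qchi_sqr // mulr1 => /(canRL (addKr _)); rewrite addrC => <-.
rewrite [LHS](bigD1 0) //= expr0n mul0r qchi0 [LHS]add0r.
by apply: eq_bigr => x x0; rewrite qchiM qchi_sqr ?mul1r.
Qed.

End QuadraticCharacter.

(** * Divisors of powers of t *)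

(* Here a, b, d, f stand for the k-th powers of w, w + c, z, z + c. *)
Lemma sum_point_identity (A : comRingType) (c t w z a b d f : A) :
  a ^+ 2 * w = w + t -> b ^+ 2 * (w + c) = w + t + c ->
  d ^+ 2 * z = z + t -> f ^+ 2 * (z + c) = z + t + c ->
  w * z * (w + c) * (z + c) * (b * d - f * a) ^+ 2 + c ^+ 2 * (z - w) ^+ 2
    = (a * f * w * (z + c) - d * b * z * (w + c)) ^+ 2.
Proof.
move=> ha hb hd hf.
transitivity ((b ^+ 2 * (w + c)) * (d ^+ 2 * z) * (w * (z + c))
  + (f ^+ 2 * (z + c)) * (a ^+ 2 * w) * (z * (w + c))
  - 2%:R * (a * b * d * f) * (w * z * (w + c) * (z + c)) + c ^+ 2 * (z - w) ^+ 2); first by ring.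
transitivity ((a ^+ 2 * w) * (f ^+ 2 * (z + c)) * (w * (z + c))
  + (d ^+ 2 * z) * (b ^+ 2 * (w + c)) * (z * (w + c))
  - 2%:R * (a * b * d * f) * (w * z * (w + c) * (z + c))); last by ring.
by rewrite ha hb hd hf; ring.
Qed.

Lemma prod_poly_neq0 (K : fieldType) (I : Type) (s : seq I) (p : I -> {poly K}) :
  (forall i, p i != 0) -> \prod_(i <- s) p i != 0.
Proof.
by move=> p0; elim/big_rec: _ => [|i x _ x0]; rewrite ?oner_neq0 // mulf_neq0.
Qed.

Lemma mup_prod (K : fieldType) (I : Type) (s : seq I) (r : K) (p : I -> {poly K}) :
  (forall i, p i != 0) -> mup r (\prod_(i <- s) p i) = (\sum_(i <- s) mup r (p i))%N.
Proof.
move=> p0; elim: s => [|i s IH]; first by rewrite !big_nil mupNroot ?root1.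
by rewrite !big_cons mupM ?IH // prod_poly_neq0.
Qed.

Lemma deg_prod (F : finFieldType) (I : Type) (s : seq I) (p : I -> {poly F}) :
  (forall i, p i != 0) -> deg (\prod_(i <- s) p i) = (\sum_(i <- s) deg (p i))%N.
Proof.
move=> p0; elim: s => [|i s IH]; first by rewrite !big_nil /deg size_poly1.
by rewrite !big_cons degM ?IH // prod_poly_neq0.
Qed.

Section TPoly.
Variable F : finFieldType.
Local Notation q := #|F|.
Local Notation t := (tpoly F).

Lemma tpoly_prod : t = \prod_(s : F) ('X - s%:P).
Proof. by rewrite tpolyE finField_genPoly. Qed.

Lemma lin_expq (a : F) : ('X - a%:P) ^+ q = 'X - a%:P + t.
Proof.
(* As the product of all monic linear polynomials over [F], [t] is invariant under translation. *)
have E : t \Po ('X - a%:P) = t.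
  rewrite tpoly_prod rmorph_prod /= (reindex_inj (addIr (- a))) /=.
  apply: eq_bigr => s _; rewrite rmorphB /= comp_polyX comp_polyC polyCB.
  by rewrite opprB addrA subrK.
rewrite -{1}E tpolyE rmorphB rmorphXn /= comp_polyX.
  ring.
Qed.

Lemma root_t (s : F) : root t s.
Proof. by rewrite /root tpolyE !horner_opE expf_card subrr. Qed.

Lemma mup_t (s : F) : mup s t = 1%N.
Proof.
apply/eqP; rewrite eqn_leq -mup_root ?t_neq0 // root_t andbT.
by apply: mup_deriv; rewrite ?t_neq0 // deriv_t rootN root1.
Qed.

(** Each element of [F] is a simple zero of [t] and there are no others, so the I_4 terms become a
    sum over [F], ready to be compared with a character sum. *)
Lemma deg_gcd_tXn (N : {poly F}) k : N != 0 ->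
  deg (gcdp N (t ^+ k)) = (\sum_(s : F) minn (mup s N) k)%N.
Proof.
move=> N0; have [L [f _]] := countable_algebraic_closure F.
have tk0 : t ^+ k != 0 by rewrite expf_neq0 ?t_neq0.
have lin0 (s : F) n : ('X - s%:P) ^+ n != 0 by rewrite expf_neq0 // polyXsubC_eq0.
have g0 : gcdp N (t ^+ k) != 0 by rewrite gcdp_eq0 negb_and N0.
have E : gcdp N (t ^+ k) %= \prod_(s : F) ('X - s%:P) ^+ (minn (mup s N) k).
  rewrite -(eqp_map f); apply: eqp_mup; rewrite ?map_poly_eq0 //.
    exact: prod_poly_neq0.
  move=> r; rewrite gcdp_map mup_gcdp ?map_poly_eq0 // rmorphXn /= mupXn ?map_poly_eq0 ?t_neq0 //.
  rewrite rmorph_prod /= mup_prod => [|s]; last by rewrite map_poly_eq0.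
  have [/existsP [s /eqP Er]|/existsPn nor] := boolP [exists s : F, f s == r].
    rewrite -Er !mup_map ?t_neq0 // mup_t muln1 (bigD1 s) //= big1 ?addn0.
      by rewrite mup_map // mup_XsubCX eqxx.
    by move=> s' s's; rewrite mup_map // mup_XsubCX (negPf s's).
  rewrite [X in (k * X)%N](_ : _ = 0%N) ?muln0 ?minn0.
    rewrite big1 // => s _; rewrite rmorphXn rmorphB /= map_polyX map_polyC /= mup_XsubCX.
    by rewrite (negPf (nor s)).
  rewrite tpoly_prod rmorph_prod /= mup_prod => [|s]; last by rewrite map_poly_eq0 polyXsubC_eq0.
  rewrite big1 // => s _; rewrite rmorphB /= map_polyX map_polyC /=.
  by rewrite mupNroot // root_XsubC eq_sym (negPf (nor s)).
rewrite (deg_eqp E) deg_prod //; apply: eq_bigr => s _.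
by rewrite degXn /deg size_XsubC muln1.
Qed.

End TPoly.

(** * The heights of P_alpha and P_alpha + P_beta *)

Lemma size_sum_monic (K : fieldType) (k n : nat) (p : nat -> {poly K}) : k%:R != 0 :> K ->
  (forall i, (i < k)%N -> p i \is monic /\ size (p i) = n.+1) ->
  size (\sum_(i < k) p i) = n.+1.
Proof.
move=> k0 hp; apply/eqP; rewrite eqn_leq; apply/andP; split.
  by apply: (leq_trans (size_sum _ _ _)); apply/bigmax_leqP => i _; rewrite (hp _ (ltn_ord i)).2.
rewrite ltnNge; apply/negP => /leq_sizeP /(_ n (leqnn n)) /eqP.
rewrite coef_sum (eq_bigr (fun=> 1)) ?sumr_const ?card_ord ?(negPf k0) // => i _.
by have [/monicP] := hp _ (ltn_ord i); rewrite lead_coefE => <- ->.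
Qed.

Lemma sum_pred1 (I : finType) (i0 : I) : (\sum_(i : I) (i == i0) = 1)%N.
Proof. by rewrite (bigD1 i0) //= eqxx big1 ?addn0 // => i /negPf ->. Qed.

Section Points.
Variables (F : finFieldType) (R : realType) (c : F) (k : nat).
Hypotheses (qk : #|F| = k.*2.+1) (two0 : 2%:R != 0 :> F) (c0 : c != 0).
Local Notation q := #|F|.
Local Notation t := (tpoly F).
Local Notation C := (c%:P).
Local Notation e := ((c ^+ 2)%:P).
Local Notation P := (t ^+ 2 - e).
Local Notation lin a := ('X - a%:P : {poly F}).
Local Notation chi := (qchi R).

Let C0 : C != 0. Proof. by rewrite polyC_eq0. Qed.
Let k0 : (0 < k)%N. Proof. exact: card_half_gt0 qk. Qed.
Let lin0 a : lin a != 0. Proof. by rewrite polyXsubC_eq0. Qed.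
Let t0 : t != 0. Proof. exact: t_neq0. Qed.

Let linC a : lin (a - c) = lin a + C.
Proof. by rewrite polyCB opprB addrA addrAC. Qed.

Let lin_sq a : (lin a ^+ k) ^+ 2 * lin a = lin a + t.
Proof. by rewrite -exprM muln2 -exprSr -qk lin_expq. Qed.

Let PE : P = (t + C) * (t - C).
Proof. by rewrite polyC_exp; ring. Qed.

Let mup_lin (s a : F) : mup s (lin a) = (s == a).
Proof. by rewrite -[lin a]expr1 mup_XsubCX eq_sym; case: eqP. Qed.

Lemma coprime_shift_lin (a s : F) : a != 0 -> coprimep (t + a%:P) (lin s).
Proof.
move=> a0; rewrite coprimep_XsubC /root !horner_opE.
by have := root_t s; rewrite /root => /eqP ->; rewrite add0r.
Qed.

(* The x-coordinate of P_al; polynomial because w divides t = w (w^(q-1) - 1). *)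
Definition pointN (al : F) : {poly F} := C * (lin al ^+ k.*2 - 1) * (lin al + t + C).

Lemma pointN_mul al : lin al * pointN al = C * t * lin (al - c) ^+ q.
Proof.
have h : lin al ^+ k.*2 * lin al = lin al + t by rewrite -exprSr -qk lin_expq.
rewrite lin_expq linC /pointN.
transitivity (C * (lin al ^+ k.*2 * lin al - lin al) * (lin al + t + C)); first by ring.
by rewrite h; ring.
Qed.

Lemma pointN_e al : pointN al + e * 1 = C * (t + C) * lin al ^+ k.*2.
Proof.
have h : lin al ^+ k.*2 * lin al = lin al + t by rewrite -exprSr -qk lin_expq.
rewrite /pointN polyC_exp.
transitivity (C * (lin al ^+ k.*2 * lin al + lin al ^+ k.*2 * (t + C) - lin al - t)); first by ring.
by rewrite h; ring.
Qed.

Lemma pointN_neq0 al : pointN al != 0.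
Proof.
have : lin al * pointN al != 0 by rewrite pointN_mul !mulf_neq0 ?expf_neq0.
by rewrite mulf_eq0 negb_or => /andP [].
Qed.

Lemma size_pointN al : size (pointN al) = (2 * q)%N.
Proof.
have E1 : size (lin al * pointN al) = (size (pointN al)).+1.
  by rewrite size_mul ?pointN_neq0 // size_XsubC.
have E2 : size (t * lin (al - c) ^+ q) = (q + q).+1.
  by rewrite size_mul ?expf_neq0 // size_exp_XsubC size_t addSn addnS.
move: E1; rewrite pointN_mul -mulrA size_Cmul // E2 => -[<-].
by rewrite mul2n addnn.
Qed.

(** The multiplicity is 1 except for 0 at [al] and [q + 1] at [al - c]; the additive form avoids
    truncated subtraction. *)
Lemma mup_pointN al s : ((s == al) + mup s (pointN al) = 1 + q * (s == (al - c)%R))%N.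
Proof.
have E1 : mup s (lin al * pointN al) = (mup s (lin al) + mup s (pointN al))%N.
  exact: mupM (lin0 al) (pointN_neq0 al).
rewrite -mup_lin -E1 pointN_mul.
rewrite mupM ?mulf_neq0 ?expf_neq0 // mupM // mupXn // mup_lin mup_t.
by rewrite (@mupNroot _ s C) ?rootC.
Qed.

(** The point misses [O] and meets component 1 at infinity. Over the zeros of [t] it meets component
    0 at [al], component 2 at [al - c], and 1 or 3 elsewhere. Among the I_2 fibres exactly those
    over the zeros of [t + c] contribute. *)
Lemma height_pointN al :
  xheight R c (pointN al) 1 = (3%:R * q%:R - 1) * (q%:R - 1) / (4%:R * q%:R) + 2%:R^-1.
Proof.
have q1 : (1 < q)%N := q_gt1 F.
have excl s : ~~ ((s == al) && (s == al - c)).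
  apply/negP => /andP [/eqP -> ]; rewrite -subr_eq0 opprB addrC subrK; exact/negP.
have d1 : (deg (gcdp (pointN al) t) + 1 = q)%N.
  rewrite -(expr1 t) deg_gcd_tXn ?pointN_neq0 // -[X in (_ + X)%N = _](sum_pred1 al) -big_split /= -[RHS]sum1_card.
  apply: eq_bigr => s _; have := mup_pointN al s; move: q1 (excl s).
  move: (mup s _) (q) (s == al) (s == (al - c)%R); clear=> m n [] [] //=; lia.
have d2 : (deg (gcdp (pointN al) (t ^+ 2)) = q)%N.
  apply: (@addIn 1%N); rewrite -[X in (_ + X)%N = _](sum_pred1 al).
  rewrite -[X in _ = (_ + X)%N](sum_pred1 (al - c)).
  rewrite deg_gcd_tXn ?pointN_neq0 // -[X in _ = (X + _)%N]sum1_card -!big_split /=.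
  apply: eq_bigr => s _; have := mup_pointN al s; move: q1 (excl s).
  move: (mup s _) (q) (s == al) (s == (al - c)%R); clear=> m n [] [] //=; lia.
have d3 : deg (gcdp (pointN al + e * 1) P) = q.
  have -> : pointN al + e * 1 = (t + C) * (C * lin al ^+ k.*2) by rewrite pointN_e; ring.
  have co : coprimep (C * lin al ^+ k.*2) (t - C).
    rewrite mul_polyC coprimepZl // coprimep_expl // coprimep_sym -polyCN.
    by rewrite coprime_shift_lin // oppr_eq0.
  have g0 : gcdp (C * lin al ^+ k.*2) (t - C) != 0.
    by rewrite gcdp_eq0 negb_and !mulf_neq0 ?expf_neq0.
  have s1 : size (t + C) = q.+1.
    by rewrite size_polyDl size_t // ltnS (leq_trans (size_polyC_leq1 _)) // ltnW.
  have tC0 : t + C != 0 by rewrite -size_poly_gt0 s1.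
  rewrite PE (deg_eqp (gcdp_mul2l _ _ _)) degM // {2}/deg (eqP co) addn0.
  by rewrite /deg s1.
rewrite /xheight d3 size_poly1 size_pointN d2.
have -> : minn (2 * q) (2 * q + 1 - 2 * q) = 1%N.
  by rewrite addKn; apply/minn_idPr; rewrite muln_gt0 (ltnW q1).
rewrite (maxn_idPl _) ?leq_addl // add1n /=.
have q0 : q%:R != 0 :> R by rewrite pnatr_eq0 -lt0n ltnW.
have -> : (deg (gcdp (pointN al) t))%:R = q%:R - 1 :> R by rewrite -d1 natrD addrK.
by rewrite /contr_inf natrM; field.
Qed.

Variables (al be : F).
Hypothesis neq : al != be.
Local Notation g := (al - be).
Let g0 : g != 0. Proof. by rewrite subr_eq0. Qed.

Let linB : lin be - lin al = g%:P.
Proof. by rewrite polyCB; ring. Qed.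

Definition sumT : {poly F} :=
  (lin (al - c) ^+ k) * (lin be ^+ k) - (lin (be - c) ^+ k) * (lin al ^+ k).
Definition sumQ : {poly F} := lin al * lin be * lin (al - c) * lin (be - c).
(* The x-coordinate of P_al + P_be. *)
Definition sumN : {poly F} := g ^- 2 *: (sumQ * sumT ^+ 2).
Definition sumU : {poly F} :=
  lin al ^+ k * lin (be - c) ^+ k * lin al * lin (be - c)
  - lin be ^+ k * lin (al - c) ^+ k * lin be * lin (al - c).

Lemma sumN_e : sumN + e * 1 = g ^- 2 *: (sumU ^+ 2).
Proof.
have g2 : g ^+ 2 != 0 by rewrite expf_neq0.
have := @sum_point_identity _ C t (lin al) (lin be) (lin al ^+ k) (lin (al - c) ^+ k)
  (lin be ^+ k) (lin (be - c) ^+ k).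
rewrite -!linC linB !lin_sq !linC => /(_ erefl).
have -> : lin al + C + t = lin al + t + C by ring.
have -> : lin be + C + t = lin be + t + C by ring.
move=> /(_ erefl erefl erefl) E.
rewrite /sumU /sumN /sumQ /sumT !linC -E scalerDr mulr1 polyC_exp; congr (_ + _).
by rewrite -!polyC_exp -polyCM -mul_polyC -polyCM mulrCA mulVf // mulr1.
Qed.

Lemma coprime_sumN_P : coprimep (sumN + e * 1) P.
Proof.
rewrite sumN_e coprimepZl ?invr_eq0 ?expf_neq0 // coprimep_expl //.
(* [V] is the conjugate of [sumU]: their product is a difference of squares, from which [lin_sq]
   eliminates the k-th powers. *)
pose V := lin al ^+ k * lin (be - c) ^+ k * lin al * lin (be - c)
  + lin be ^+ k * lin (al - c) ^+ k * lin be * lin (al - c).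
pose w := lin al; pose z := lin be.
(* Modulo t + C and t - C, the multiple W of sumU is a constant times a product of linear factors
   that divide t. *)
pose W := (w + t) * (z + t + C) * (w * (z + C)) - (z + t) * (w + t + C) * (z * (w + C)).
have UV : sumU * V = W.
  rewrite /W /w /z -!linC.
  have -> : lin be + t + C = lin (be - c) + t by rewrite linC; ring.
  have -> : lin al + t + C = lin (al - c) + t by rewrite linC; ring.
  by rewrite -!lin_sq /sumU /V; ring.
have coW : coprimep P W.
  rewrite PE coprimepMl; apply/andP; split.
    have -> : W = (w * (z + C) - z * (w + C)) * (w + z + t) * (t + C)
      + (- (2%:R * c * g) *: (w * z)).
      rewrite -mul_polyC polyCN !polyCM -linB -/w -/z polyC_natr /W; ring.
    rewrite coprimep_addl_mul coprimepZr ?oppr_eq0 ?mulf_neq0 // coprimepMr.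
    by rewrite !coprime_shift_lin.
  have -> : W = (w * (z + C) - z * (w + C)) * (w + z + 2%:R * C + t) * (t - C)
    + (- (2%:R * c * g) *: (lin (al - c) * lin (be - c))).
    rewrite !linC -mul_polyC polyCN !polyCM -linB -/w -/z polyC_natr /W; ring.
  rewrite coprimep_addl_mul coprimepZr ?oppr_eq0 ?mulf_neq0 // coprimepMr -polyCN.
  by rewrite !coprime_shift_lin ?oppr_eq0.
by rewrite coprimep_sym; apply: coprimep_dvdl coW; rewrite -UV dvdp_mulIl.
Qed.

Let k_neq0 : k%:R != 0 :> F.
Proof.
apply/negP => /eqP kz; have := natr_cardF F.
by rewrite qk -addn1 natrD -muln2 natrM kz mul0r add0r => /eqP; rewrite oner_eq0.
Qed.

(** [T] is a difference of k-th powers of two quadratics whose difference is the constant [c * g].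
    Its degree thus drops from [2k] to [2(k - 1)], with leading coefficient [k c g]; this places the
    sum on component 2 at infinity. *)
Lemma sumT_E : sumT = (c * g) *: \sum_(i < k)
  (lin (al - c) * lin be) ^+ (k.-1 - i) * (lin (be - c) * lin al) ^+ i.
Proof.
rewrite /sumT -!exprMn subrXX -mul_polyC; congr (_ * _).
by rewrite !linC polyCM -linB; ring.
Qed.

Lemma size_sumT : size sumT = (2 * k.-1).+1.
Proof.
rewrite sumT_E size_scale ?mulf_neq0 //.
apply: (size_sum_monic (p := fun i => (lin (al - c) * lin be) ^+ (k.-1 - i)
  * (lin (be - c) * lin al) ^+ i)) => // i lt_ik.
have mon u v n : (lin u * lin v) ^+ n \is monic by rewrite monic_exp // monicMl ?monicXsubC.
have sz u v n : size ((lin u * lin v) ^+ n) = (2 * n).+1.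
  have := size_exp (lin u * lin v) n; rewrite size_mul // !size_XsubC /= => <-.
  by rewrite prednK // size_poly_gt0 expf_neq0 // mulf_neq0.
split; first by rewrite monicMl.
rewrite size_Mmonic ?mon ?monic_neq0 // !sz addSn addnS /= -mulnDr subnK //.
by rewrite -ltnS prednK.
Qed.

Let sumT_neq0 : sumT != 0. Proof. by rewrite -size_poly_gt0 size_sumT. Qed.
Let sumQ_neq0 : sumQ != 0. Proof. by rewrite !mulf_neq0. Qed.

Lemma sumN_neq0 : sumN != 0.
Proof. by rewrite scaler_eq0 invr_eq0 negb_or !mulf_neq0 ?expf_neq0. Qed.

Lemma size_sumN : size sumN = (2 * q - 1)%N.
Proof.
rewrite size_scale ?invr_eq0 ?expf_neq0 //.
have T2 : sumT ^+ 2 != 0 by rewrite expf_neq0.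
have szT : size (sumT ^+ 2) = (4 * k.-1).+1.
  have := size_exp sumT 2; rewrite size_sumT /= => E.
  by rewrite -(prednK (_ : 0 < size (sumT ^+ 2))%N) ?size_poly_gt0 // E mulnAC.
have szQ : size sumQ = 5 by rewrite /sumQ !size_mul ?mulf_neq0 // !size_XsubC.
rewrite size_mul // szT szQ qk; move: k0; case: (k) => // n _; clear; rewrite /= -mul2n; lia.
Qed.

Lemma mup_sumQ s :
  mup s sumQ = ((s == al) + (s == be) + (s == (al - c)%R) + (s == (be - c)%R))%N.
Proof. by rewrite /sumQ !mupM ?mulf_neq0 // !mup_lin. Qed.

Lemma mup_sumN s : mup s sumN = (mup s sumQ + 2 * mup s sumT)%N.
Proof.
rewrite mupZ ?invr_eq0 ?expf_neq0 // -(mupXn s 2 sumT_neq0).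
exact: mupM sumQ_neq0 (expf_neq0 2 sumT_neq0).
Qed.

(** If [sumQ] is nonzero at [s], then [sumN] has there either no zero ([chi = -1]) or a multiple one
    ([chi = 1]), contributing 0 or 1. If [sumQ] vanishes, [sumT] does not, and the zero of order 1
    or 2 contributes 3/4 or 1. *)
Lemma local_contr s :
  (minn (mup s sumN) 1)%:R / 2%:R + (minn (mup s sumN) 2)%:R / 4%:R
  = (1 + chi sumQ.[s]) / 2%:R + (mup s sumQ)%:R / 4%:R :> R.
Proof.
have Q0 : (sumQ.[s] == 0) = (0 < mup s sumQ)%N by rewrite -mup_root.
have T0 : (sumT.[s] == 0) = (0 < mup s sumT)%N by rewrite -mup_root.
pose x := (s - (al - c)) * (s - be); pose y := (s - (be - c)) * (s - al).
have Qs : sumQ.[s] = x * y.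
  by rewrite /sumQ !hornerM !hornerXsubC /x /y; ring.
have Ts : sumT.[s] = x ^+ k - y ^+ k.
  by rewrite /sumT /x /y !(hornerD, hornerN, hornerM, horner_exp, hornerX, hornerC) -!exprMn.
have xy : x - y = c * g by rewrite /x /y; ring.
have xy0 : x - y != 0 by rewrite xy mulf_neq0.
have zk : 0 ^+ k = 0 :> F by rewrite expr0n (gtn_eqF k0).
have [Qz|Qnz] := eqVneq sumQ.[s] 0.
  have Tnz : sumT.[s] != 0.
    rewrite Ts; move/eqP: Qz; rewrite Qs mulf_eq0 => /orP [] /eqP Z; move: xy0; rewrite Z.
      by rewrite zk !sub0r !oppr_eq0 => y0; rewrite expf_neq0.
    by rewrite zk !subr0 => x0; rewrite expf_neq0.
  have mT : mup s sumT = 0%N by apply/eqP; rewrite -leqn0 leqNgt -T0.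
  (* Order 2 does occur, when [al = be - c] or [be = al - c]; allowing it keeps the formula uniform
     over all [al != be]. *)
  have mQ : (0 < mup s sumQ <= 2)%N.
    rewrite -Q0 Qz eqxx mup_sumQ /=.
    have n1 : ~~ ((s == al) && (s == be)) by apply/negP => /andP [/eqP ->]; exact/negP.
    have n2 : ~~ ((s == al - c) && (s == be - c)).
      by apply/negP => /andP [/eqP ->]; rewrite (inj_eq (addIr _)); exact/negP.
    by move: n1 n2; do 4?case: (s == _).
  rewrite Qz (qchi0 F R) mup_sumN mT muln0 addn0.
  by move: mQ; case: (mup s sumQ) => [|[|[|m]]] //= _; rewrite /minn /=; lra.
have mQ : mup s sumQ = 0%N by apply/eqP; rewrite -leqn0 leqNgt -Q0.
have /andP [x0 y0] : (x != 0) && (y != 0) by rewrite -negb_or -mulf_eq0 -Qs.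
rewrite mup_sumN mQ add0n (qchiE R qk) // Qs exprMn.
(* Since [y ^+ k] is its own inverse, the product is 1 exactly when the two powers agree. *)
have -> : (x ^+ k * y ^+ k == 1) = (sumT.[s] == 0).
  have y2 : y ^+ k * y ^+ k = 1 by rewrite -exprD addnn (expf_double qk).
  by rewrite Ts subr_eq0 -[in LHS]y2 (inj_eq (mulIf _)) // expf_neq0.
rewrite T0; case: (mup s sumT) => [|m] /=; rewrite ?muln0 ?min0n.
  by lra.
have -> : minn (2 * m.+1) 1 = 1%N by rewrite mulnS; apply/minn_idPr.
have -> : minn (2 * m.+1) 2 = 2%N by rewrite mulnS; apply/minn_idPr; rewrite leq_addr.
by lra.
Qed.

(** The second term is [contr_inf] at component 2, the I_2 fibres contribute nothing, and the final
    1 is a quarter of the number of roots of [sumQ]. *)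
Lemma height_sumN :
  xheight R c sumN 1 = 2%:R * q%:R - (4%:R * q%:R - 2%:R) / (2%:R * q%:R)
    - (q%:R + \sum_(s : F) chi ((s - al) * (s - be) * (s - (al - c)) * (s - (be - c)))) / 2%:R - 1.
Proof.
have q1 : (1 < q)%N := q_gt1 F.
have d3 : deg (gcdp (sumN + e * 1) P) = 0%N by rewrite /deg (eqP coprime_sumN_P).
have q0 : q%:R != 0 :> R by rewrite pnatr_eq0 -lt0n ltnW.
have S : (deg (gcdp sumN t))%:R / 2%:R + (deg (gcdp sumN (t ^+ 2)))%:R / 4%:R
  = (q%:R + \sum_(s : F) chi ((s - al) * (s - be) * (s - (al - c)) * (s - (be - c)))) / 2%:R + 1 :> R.
  rewrite -{1}(expr1 t) !deg_gcd_tXn ?sumN_neq0 // !natr_sum !mulr_suml -big_split /=.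
  rewrite (eq_bigr _ (fun s _ => local_contr s)) big_split /= -!mulr_suml -natr_sum.
  rewrite big_split /= sumr_const /=.
  have -> : (\sum_(s : F) mup s sumQ = 4)%N.
    by rewrite (eq_bigr _ (fun s _ => mup_sumQ s)) !big_split /= !sum_pred1.
  congr (_ / _ + _); last by rewrite divff // pnatr_eq0.
  congr (_ + _); apply: eq_bigr => s _; congr (chi _).
  by rewrite /sumQ !hornerM !hornerXsubC.
have k1 := k0.
have m2 : minn (2 * q) (2 * q + 1 - (2 * q - 1)) = 2%N by move: q1; move: (q); clear=> n; lia.
have M : (maxn (1 + 2 * q) (2 * q - 1)).-1 = (2 * q)%N by move: q1; move: (q); clear=> n; lia.
rewrite /xheight d3 size_poly1 size_sumN m2 M mul0r subr0.
move: S => /(canRL (addrK _)) ->.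
by rewrite /contr_inf natrM; field.
Qed.

End Points.

(** * The points on E *)

Section PointAlgebra.
Variables (K : fieldType) (c t : K).
Definition point_x (w : K) := c * t * (w + t + c) / w.
Definition point_y (w m : K) := c * t * (c + t) * m / w ^+ 2.

(** Here [a] and [b] stand for [w^k] and [(w + c)^k], so that [a b w (w + c)] is the power of
    exponent [(q + 1)/2] in [Palpha], with no exponent depending on [q] left. *)
Lemma point_on_curve (w a b : K) : w != 0 ->
  a ^+ 2 * w = w + t -> b ^+ 2 * (w + c) = w + t + c ->
  point_y w (a * b * w * (w + c)) ^+ 2 = point_x w * (point_x w + c ^+ 2) * (point_x w + t ^+ 2).
Proof.
move=> w0 ha hb; rewrite /point_x /point_y.
transitivity (c ^+ 2 * t ^+ 2 * (c + t) ^+ 2 * ((a ^+ 2 * w) * (b ^+ 2 * (w + c)) * (w * (w + c)))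
  / w ^+ 4); first by field.
by rewrite ha hb; field.
Qed.

Variables (w z a b d f : K).
Hypotheses (c0 : c != 0) (t0 : t != 0) (tc : t + c != 0) (w0 : w != 0) (z0 : z != 0).
Hypotheses (zw : z - w != 0) (wtc : w + t + c != 0) (ztc : z + t + c != 0).
Hypotheses (hb : b ^+ 2 * (w + c) = w + t + c) (hf : f ^+ 2 * (z + c) = z + t + c).

Lemma point_x_sub : point_x w - point_x z = c * (z - w) * t * (t + c) / (w * z).
Proof. by rewrite /point_x; field; rewrite w0 z0. Qed.

Lemma point_x_neq : point_x w != point_x z.
Proof.
rewrite -subr_eq0 point_x_sub; apply: mulf_neq0; last by rewrite invr_eq0 mulf_neq0.
by rewrite !mulf_neq0.
Qed.

Lemma sum_third (x3 : K) :
  x3 * (point_x w * point_x z) * (point_x w - point_x z) ^+ 2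
    = (point_x w * point_y z (d * f * z * (z + c)) - point_x z * point_y w (a * b * w * (w + c))) ^+ 2 ->
  x3 = (z - w) ^- 2 * (w * z * (w + c) * (z + c) * (b * d - f * a) ^+ 2).
Proof.
have px0 v : v != 0 -> v + t + c != 0 -> point_x v != 0.
  by move=> v0 vtc; rewrite /point_x !mulf_neq0 ?invr_eq0.
have den0 : point_x w * point_x z * (point_x w - point_x z) ^+ 2 != 0.
  have d0 : point_x w - point_x z != 0 by rewrite subr_eq0 point_x_neq.
  exact: mulf_neq0 (mulf_neq0 (px0 _ w0 wtc) (px0 _ z0 ztc)) (expf_neq0 2 d0).
move=> E; apply: (mulIf den0); rewrite [LHS]mulrA E point_x_sub /point_x /point_y -hb -hf.
by field; rewrite w0 z0 zw.
Qed.

End PointAlgebra.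

Section PointsOnE.
Variables (F : finFieldType) (R : realType) (b : F) (k : nat).
Local Notation q := #|F|.
Local Notation K := (Kq F).
Local Notation tof := (@FracField.tofrac {poly F}).
Local Notation t := (tpoly F).
Local Notation c := (4%:R * b).
Local Notation lin a := ('X - a%:P : {poly F}).
Hypotheses (qk : q = k.*2.+1) (two0 : 2%:R != 0 :> F) (b0 : b != 0).

Let c0 : c != 0. Proof. by rewrite mulf_neq0 // (natrM _ 2 2) mulf_neq0. Qed.
Let lin0 a : lin a != 0. Proof. by rewrite polyXsubC_eq0. Qed.
Let tlin0 a : tof (lin a) != 0. Proof. by rewrite tofrac_eq0. Qed.

Let linC a : tof (lin (a - c)) = tof (lin a) + tof c%:P.
Proof. by rewrite -tofracD; congr tof; rewrite polyCB opprB addrA addrAC. Qed.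

Let tof_sq a : tof (lin a ^+ k) ^+ 2 * tof (lin a) = tof (lin a) + tof t.
Proof. by rewrite -tofracXn -tofracM -tofracD -exprM muln2 -exprSr -qk lin_expq. Qed.

Let tof_sqC a : tof (lin (a - c) ^+ k) ^+ 2 * (tof (lin a) + tof c%:P)
  = tof (lin a) + tof t + tof c%:P.
Proof. by rewrite -linC tof_sq linC addrAC. Qed.

Let yP a := point_y (tof c%:P) (tof t) (tof (lin a))
  (tof (lin a ^+ k) * tof (lin (a - c) ^+ k) * tof (lin a) * (tof (lin a) + tof c%:P)).
Let xP a := point_x (tof c%:P) (tof t) (tof (lin a)).

Lemma Palpha_E a : Palpha b a = Some (xP a, yP a).
Proof.
have Ew : uK F - cK a = tof (lin a) by rewrite tofracB.
have Ewq : tof (lin a) ^+ q = tof (lin a) + tof t.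
  by rewrite -tofracXn lin_expq tofracD.
have half : (q.+1)./2 = k.+1 by rewrite qk -doubleS doubleK.
have Em : (tof (lin a) ^+ 2 + tof c%:P * tof (lin a)) ^+ k.+1
  = tof (lin a ^+ k) * tof (lin (a - c) ^+ k) * tof (lin a) * (tof (lin a) + tof c%:P).
  have -> : tof (lin a) ^+ 2 + tof c%:P * tof (lin a) = tof (lin a) * tof (lin (a - c)).
    by rewrite linC mulrDr expr2 [X in _ + X]mulrC.
  rewrite -linC exprMn !exprSr -!tofracXn.
  by rewrite -!mulrA; congr (_ * _); rewrite mulrCA.
by rewrite /Palpha Ew tKE half Ewq /cK Em.
Qed.

Lemma xP_E a : xP a = tof (pointN c k a).
Proof.
apply: (mulIf (tlin0 a)); rewrite [LHS]divfK; last exact: tlin0.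
have := congr1 tof (pointN_mul c qk a); rewrite tofracM mulrC => ->.
rewrite lin_expq !tofracM [tof (_ + t)]tofracD linC; congr (_ * _).
by rewrite addrAC.
Qed.

Lemma has_height_P a : has_height b (Palpha b a) (xheight R c (pointN c k a) 1).
Proof.
rewrite Palpha_E; split.
  apply/(on_E_factor b); rewrite /xP /yP polyC_exp [tof (c%:P ^+ 2)]tofracXn.
  exact: point_on_curve (tlin0 a) (tof_sq a) (tof_sqC a).
exists (pointN c k a), 1; rewrite coprimep1 oner_neq0; split=> //.
by rewrite tofrac1 divr1 xP_E.
Qed.

Lemma has_height_sum al be : al != be ->
  has_height b (Eadd b (Palpha b al) (Palpha b be)) (xheight R c (sumN c k al be) 1).
Proof.
move=> neq.
have tc0 : tof c%:P != 0 by rewrite tofrac_eq0 polyC_eq0.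
have tt0 : tof t != 0 by rewrite tofrac_eq0 t_neq0.
have ttc : tof t + tof c%:P != 0.
  rewrite -tofracD tofrac_eq0 -size_poly_gt0 size_polyDl size_t //.
  by rewrite ltnS (leq_trans (size_polyC_leq1 _)) // ltnW // q_gt1.
have zw : tof (lin be) - tof (lin al) != 0.
  rewrite -tofracB tofrac_eq0 (_ : lin be - lin al = (al - be)%:P).
    by rewrite polyC_eq0 subr_eq0.
  by rewrite polyCB; ring.
have wtc a : tof (lin a) + tof t + tof c%:P != 0.
  rewrite -tof_sqC -linC; apply: mulf_neq0; last exact: tlin0.
  by apply: expf_neq0; rewrite tofrac_eq0 expf_neq0.
have onE a := (has_height_P a).
have xneq : xP al != xP be := point_x_neq tc0 tt0 ttc (tlin0 al) (tlin0 be) zw.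
have := onE al; have := onE be; rewrite !Palpha_E /Eadd /= => -[on2 _] [on1 _].
rewrite (negPf xneq) /=.
have [on3 E3] := secant_third on1 on2 xneq erefl erefl.
split=> //; exists (sumN c k al be), 1; rewrite coprimep1 oner_neq0 tofrac1 divr1; split=> //.
rewrite (sum_third tc0 tt0 ttc (tlin0 al) (tlin0 be) zw (wtc al) (wtc be) (tof_sqC al) (tof_sqC be) E3).
rewrite /sumN -mul_polyC tofracM; congr (_ * _).
  rewrite -!tofracB (_ : lin be - lin al = (al - be)%:P); last by rewrite polyCB; ring.
  have g2 : (al - be) ^+ 2 != 0 by rewrite expf_neq0 // subr_eq0.
  have tg2 : tof ((al - be) ^+ 2)%:P != 0 by rewrite tofrac_eq0 polyC_eq0.
  have gE : tof ((al - be)%:P) ^+ 2 = tof ((al - be) ^+ 2)%:P by rewrite -tofracXn -polyC_exp.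
  rewrite gE; apply: (mulIf tg2); rewrite -[RHS]tofracM -polyCM (mulVf g2) polyC1 tofrac1.
  exact: mulVf tg2.
have EQ : tof (sumQ c al be) = tof (lin al) * tof (lin be) * (tof (lin al) + tof c%:P)
    * (tof (lin be) + tof c%:P).
  by rewrite -!linC -!tofracM.
have ET : tof (sumT c k al be) = tof (lin (al - c) ^+ k) * tof (lin be ^+ k)
    - tof (lin (be - c) ^+ k) * tof (lin al ^+ k).
  by rewrite -!tofracM -tofracB.
by rewrite [RHS]tofracM [tof (_ ^+ 2)]tofracXn EQ ET.
Qed.

Lemma pairing_diag a : height_pairing R b (Palpha b a) (Palpha b a)
  = (3%:R * q%:R - 1) * (q%:R - 1) / (4%:R * q%:R) + 2%:R^-1.
Proof.
rewrite /height_pairing (hhatE two0 b0 (has_height_dbl two0 b0 (has_height_P a))).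
rewrite (hhatE two0 b0 (has_height_P a)) (height_pointN R qk c0).
by move: (_ / _ + _) => h; field.
Qed.

(** Valid for all distinct [al], [be]: the two off-diagonal cases of the theorem differ only in how
    the character sum is evaluated. *)
Lemma pairing_off_diag al be : al != be ->
  height_pairing R b (Palpha b al) (Palpha b be)
  = (1 - 3%:R * q%:R) / (4%:R * q%:R) - 4%:R^-1
    - 4%:R^-1 * \sum_(x : F) qchi R (x * (x + c) * (x - (al - be)) * (x - (al - be) + c)).
Proof.
move=> neq; rewrite /height_pairing (hhatE two0 b0 (has_height_sum neq)).
rewrite !(hhatE two0 b0 (has_height_P _)) !(height_pointN R qk c0) (height_sumN R qk two0 c0 neq).
rewrite (reindex_inj (addIr be)) /=.
under [X in q%:R + X]eq_bigr => x _.
  have -> : (x + be - al) * (x + be - be) * (x + be - (al - c)) * (x + be - (be - c))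
    = x * (x + c) * (x - (al - be)) * (x - (al - be) + c) by ring.
  over.
have q0 : q%:R != 0 :> R by rewrite pnatr_eq0 -lt0n ltnW // q_gt1.
by move: (\sum_x _) => S; field.
Qed.

End PointsOnE.

Theorem theorem7p6 (F : finFieldType) (R : realType) (b : F)
  (hq : odd #|F|) (hb0 : b ^+ 2 != 0) (hb1 : b ^+ 2 != 1) (alpha beta : F) :
  let q : R := (#|F|)%:R in
  let pr := height_pairing R b (Palpha b alpha) (Palpha b beta) in
  [/\ alpha = beta ->
        pr = (3%:R * q - 1) * (q - 1) / (4%:R * q) + 2%:R^-1,
      alpha - beta = 4%:R * b \/ alpha - beta = - (4%:R * b) ->
        pr = (1 - 3%:R * q) / (4%:R * q) + 4%:R^-1 * qchi R (-1 : F)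
    & alpha - beta != 0 -> alpha - beta != 4%:R * b -> alpha - beta != - (4%:R * b) ->
        pr = (1 - 3%:R * q) / (4%:R * q) + 4%:R^-1 * trg R b (alpha - beta)].
Proof.
have [k qk] : exists k, #|F| = k.*2.+1.
  by exists #|F|./2; rewrite -[LHS]odd_double_half hq.
have two0 : 2%:R != 0 :> F.
  apply/eqP => z; have /eqP := natr_cardF F.
  by rewrite qk -addn1 natrD -muln2 natrM z mulr0 add0r oner_eq0.
have b0 : b != 0 by rewrite -sqrf_eq0.
have c0 : 4%:R * b != 0 by rewrite mulf_neq0 // (natrM _ 2 2) mulf_neq0.
move=> q pr; rewrite {}/pr; split.
- by move=> <-; apply: (pairing_diag R qk two0 b0).
- move=> hc.
  have neq : alpha != beta.
    rewrite -subr_eq0; case: hc => ->; first exact: c0.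
    by rewrite oppr_eq0.
  rewrite (pairing_off_diag R qk two0 b0 neq).
  have -> : \sum_(x : F) qchi R (x * (x + 4%:R * b) * (x - (alpha - beta))
      * (x - (alpha - beta) + 4%:R * b)) = -1 - qchi R (-1 : F).
    rewrite -(sum_qchi_double_root R qk two0 c0); case: hc => ->.
      by apply: eq_bigr => x _; congr qchi; ring.
    (* For [gamma = -4b] the double root is at [-4b]; the shift moves it to 0. *)
    rewrite (reindex_inj (addIr (- (4%:R * b)))) /=.
    by apply: eq_bigr => x _; congr qchi; ring.
  by rewrite -/q; lra.
- rewrite subr_eq0 => neq _ _; rewrite (pairing_off_diag R qk two0 b0 neq) /trg -/q.
  by move: (\sum_(x : F) _) => S; lra.
Qed.
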